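(* Let a port-Hamiltonian full-order system be given by $(J,R,Q,G,P,S,N)$, with $A=(J-R)Q\in\mathbb{R}^{n\times n}$ and $B=G-P\in\mathbb{R}^{n\times m}$, and assume it is asymptotically stable. Let $\tilde\Sigma$: $\dot{\tilde x}=\tilde A\tilde x+\tilde Bu$, $\tilde y=\tilde C\tilde x+\tilde Du$ with $\tilde A\in\mathbb{R}^{r\times r}$, $\tilde B\in\mathbb{R}^{r\times m}$, $\tilde C\in\mathbb{R}^{m\times r}$, $\tilde D\in\mathbb{R}^{m\times m}$ be a minimal, asymptotically stable and passive system. Let $$\mathcal J(\tilde Q)=\tfrac14\operatorname{tr}(\mathcal PQ\mathcal PQ)+\tfrac14\operatorname{tr}(\tilde{\mathcal P}\tilde Q\tilde{\mathcal P}\tilde Q)-\tfrac12\operatorname{tr}(Y^{\mathsf T}QY\tilde Q),$$ where $\mathcal P$, $\tilde{\mathcal P}$, $Y$ are the unique solutions of $A\mathcal P+\mathcal PA^{\mathsf T}+BB^{\mathsf T}=0$, $\tilde A\tilde{\mathcal P}+\tilde{\mathcal P}\tilde A^{\mathsf T}+\tilde B\tilde B^{\mathsf T}=0$, $AY+Y\tilde A^{\mathsf T}+B\tilde B^{\mathsf T}=0$. Then the optimization problem $$\min_{\tilde Q}\ \mathcal J(\tilde Q)\quad\text{over symmetric positive definite }\tilde Q\in\mathbb{R}^{r\times r}\text{ subject to }\begin{bmatrix}-\tilde A^{\mathsf T}\tilde Q-\tilde Q\tilde A&\tilde C^{\mathsf T}-\tilde Q\tilde B\\ \tilde C-\tilde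 B^{\mathsf T}\tilde Q&\tilde D+\tilde D^{\mathsf T}\end{bmatrix}\succcurlyeq0$$ is solvable (a minimizer exists) and has a unique solution.
   Context: A port-Hamiltonian system is a linear system $\dot x=(J-R)Qx+(G-P)u$, $y=(G+P)^{\mathsf T}Qx+(S-N)u$ with real matrices such that $\begin{bmatrix}J&G\\-G^{\mathsf T}&N\end{bmatrix}$ is skew-symmetric, $\begin{bmatrix}R&P\\P^{\mathsf T}&S\end{bmatrix}$ is symmetric positive semidefinite, and $Q$ is symmetric positive semidefinite; its Hamiltonian is $\tfrac12x^{\mathsf T}Qx$. Asymptotically stable means that all eigenvalues of $A$ (respectively $\tilde A$) lie in the open left half-plane. Minimal means controllable and observable. Passive means that there is a nonnegative storage function $\mathcal S$ on the state space with $\mathcal S(0)=0$ and $\mathcal S(\tilde x(t_1))-\mathcal S(\tilde x(t_0))\le\int_{t_0}^{t_1}\tilde y(t)^{\mathsf T}u(t)\,dt$ along all trajectories, $t_0\le t_1$. The quantity $\mathcal J(\tilde Q)$ is the squared $\mathcal H_2$-distance between the systems $\dot x=Ax+Bu$, $y_{\mathcal H}=\tfrac12x^{\mathsf T}Qx$ and $\dot{\tilde x}=\tilde A\tilde x+\tilde Bu$, $\tilde y_{\mathcal H}=\tfrac12\tilde x^{\mathsf T}\tilde Q\tilde x$ with quadratic outputs. $M\succcurlyeq0$ means $M$ is symmetric positive semidefinite. *)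

(* Defs.v *)
From HB Require Import structures.
From mathcomp Require Import all_boot all_order all_algebra.
From mathcomp Require Import all_classical all_reals all_analysis.
From mathcomp Require Import complex.

Set Implicit Arguments.
Unset Strict Implicit.
Unset Printing Implicit Defensive.

Import Order.TTheory GRing.Theory Num.Theory.
Import numFieldNormedType.Exports.

Local Open Scope classical_set_scope.
Local Open Scope ring_scope.

Definition psdmx (R : realType) (k : nat) (M : 'M[R]_k) : Prop :=
  M^T = M /\ forall x : 'cV[R]_k, 0 <= (x^T *m M *m x) 0 0.

Definition pdmx (R : realType) (k : nat) (M : 'M[R]_k) : Prop :=
  M^T = M /\ forall x : 'cV[R]_k, x != 0 -> 0 < (x^T *m M *m x) 0 0.

(* The Hamiltonian weight is called [Q]; [Rd] is the dissipation matrix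
   (the letter [R] being the field of reals). *)
Definition port_hamiltonian (R : realType) (n m : nat)
    (J Rd Q : 'M[R]_n) (G P : 'M[R]_(n, m)) (S N : 'M[R]_m) : Prop :=
  [/\ (block_mx J G (- G^T) N)^T = - block_mx J G (- G^T) N,
      psdmx (block_mx Rd P P^T S)
    & psdmx Q].

(* The eigenvalues range over the complex numbers [R[i]]. *)
Definition asymptotically_stable (R : realType) (k : nat) (A : 'M[R]_k) : Prop :=
  forall l : R[i], eigenvalue (map_mx (real_complex R) A) l -> complex.Re l < 0.

(* State trajectories of x' = A x + B u with continuous input, defined on the
   whole time axis: every trajectory on a compact interval with continuous
   input is the restriction of one of these.  Derivative and continuity are
   entrywise, so that the dimensions [k] and [m] may also be zero. *)
Definition trajectory (R : realType) (k m : nat)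
    (A : 'M[R]_k) (B : 'M[R]_(k, m))
    (u : R -> 'cV[R]_m) (x : R -> 'cV[R]_k) : Prop :=
  (forall j, continuous (fun t : R => u t j 0)) /\
  (forall (t : R) i,
     is_derive t (1 : R) (fun s : R => x s i 0) ((A *m x t + B *m u t) i 0)).

Definition controllable (R : realType) (k m : nat)
    (A : 'M[R]_k) (B : 'M[R]_(k, m)) : Prop :=
  forall x0 x1 : 'cV[R]_k, exists (T : R) (u : R -> 'cV[R]_m) (x : R -> 'cV[R]_k),
    [/\ 0 < T, trajectory A B u x, x 0 = x0 & x T = x1].

Definition observable (R : realType) (k m p : nat)
    (A : 'M[R]_k) (B : 'M[R]_(k, m)) (C : 'M[R]_(p, k)) (D : 'M[R]_(p, m)) : Prop :=
  exists2 T : R, 0 < T &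
    forall (u : R -> 'cV[R]_m) (x1 x2 : R -> 'cV[R]_k),
      trajectory A B u x1 -> trajectory A B u x2 ->
      (forall t : R, 0 <= t <= T ->
         C *m x1 t + D *m u t = C *m x2 t + D *m u t) ->
      x1 0 = x2 0.

Definition minimal (R : realType) (k m p : nat)
    (A : 'M[R]_k) (B : 'M[R]_(k, m)) (C : 'M[R]_(p, k)) (D : 'M[R]_(p, m)) : Prop :=
  controllable A B /\ observable A B C D.

Definition passive (R : realType) (k m : nat)
    (A : 'M[R]_k) (B : 'M[R]_(k, m)) (C : 'M[R]_(m, k)) (D : 'M[R]_m) : Prop :=
  exists V : 'cV[R]_k -> R,
    [/\ V 0 = 0,
        forall x, 0 <= V x
      & forall (u : R -> 'cV[R]_m) (x : R -> 'cV[R]_k) (t0 t1 : R),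
          trajectory A B u x -> t0 <= t1 ->
          V (x t1) - V (x t0) <=
            \int[@lebesgue_measure R]_(t in `[t0, t1])
               (((C *m x t + D *m u t)^T *m u t) 0 0)].

Definition sylvester_eq (R : realType) (k l m : nat)
    (A : 'M[R]_k) (B : 'M[R]_(k, m)) (F : 'M[R]_l) (E : 'M[R]_(l, m))
    (X : 'M[R]_(k, l)) : Prop :=
  A *m X + X *m F^T + B *m E^T = 0.

Definition h2_cost (R : realType) (n r : nat)
    (Q P : 'M[R]_n) (Pt : 'M[R]_r) (Y : 'M[R]_(n, r)) (Qt : 'M[R]_r) : R :=
  4^-1 * \tr (P *m Q *m P *m Q) + 4^-1 * \tr (Pt *m Qt *m Pt *m Qt)
  - 2^-1 * \tr (Y^T *m Q *m Y *m Qt).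

Definition kyp_feasible (R : realType) (r m : nat)
    (A : 'M[R]_r) (B : 'M[R]_(r, m)) (C : 'M[R]_(m, r)) (D : 'M[R]_m)
    (X : 'M[R]_r) : Prop :=
  pdmx X /\
  psdmx (block_mx (- (A^T *m X) - X *m A) (C^T - X *m B)
                  (C - B^T *m X)          (D + D^T)).

Definition minimizer (R : realType) (T : Type) (F : T -> Prop) (f : T -> R)
    (x : T) : Prop :=
  F x /\ forall y, F y -> f x <= f y.

(* Main.v *)
Require Import Defs.
From mathcomp Require Import all_boot all_order all_algebra.
From mathcomp Require Import all_classical all_reals all_analysis.
From mathcomp Require Import complex.
From mathcomp Require Import ring lra.

(** Up to a constant, the cost is a squared distance to a fixed matrix.  The
    reduced Gramian [Pt] is positive definite, so it factors as [G *m G^T] with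
    [G] invertible; in the variable [V = G^T *m X *m G] the cost reads
    [4^-1 * |V - W|^2 + c] for the Frobenius norm ([h2_cost_square]).  The
    feasible set is convex and closed, so everything reduces to the projection
    of [W] onto a nonempty closed convex set, which exists and is unique by the
    parallelogram identity ([nested_min_norm]).  Strict definiteness of [X] is
    no obstacle to closedness: stability and observability force every symmetric
    solution of the matrix inequality to be positive definite ([kyp_pd]).

    The difficulty is to see that the feasible set is not empty, that is, that a
    passive system admits a quadratic storage function (the positive real, or
    Kalman-Yakubovich-Popov, lemma), while the given storage function need not
    even be continuous.

    - Feeding the system with exponentials gives the frequency domain inequality
      ([passive_positive_real]): if [s w = A w + B h] with [0 <= Re s], then
      [0 <= Re (h^* (C w + D h))].  The inputs [Re (e^{st} h)] and
      [Im (e^{st} h)] together supply power exactly [e^{2 Re s t}] times that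
      real part, and passivity forbids extracting unbounded energy.
    - A convexity argument of Rantzer turns this into an approximate solution of
      the matrix inequality.  Let [E] be the element of least norm in the closure
      of the set of differences between a positive semidefinite matrix and a
      value [kyp X]; it separates the two sets.  Being a separator, [E] is
      positive semidefinite, its blocks satisfy a Lyapunov equation, and it has a
      nonpositive product with [kyp 0].  Under the Lyapunov equation [E] is a sum
      of rank one terms [(w, h) (w, h)^*] with [A w + B h = i omega w], plus a
      term seen by [D] only, so the frequency inequality gives the opposite sign
      ([positive_real_trace_ge0]).  Hence [E = 0]: for every [eta > 0] some
      symmetric [X] has [kyp X + eta] positive semidefinite ([kyp_approx]).
    - Controllability bounds all these [X] at once ([kyp_bounded]): the function
      [x^T X x] grows at a bounded rate along a fixed trajectory from [0] to [v],
      and along one from [v] to [0].  Elements of almost least norm of the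
      decreasing sets obtained for [eta = 1, 1/2, 1/3, ...] form a Cauchy sequence,
      whose limit solves the exact inequality ([kyp_solvable]).

    The remaining ingredients are linear algebra: unique solvability of Sylvester
    equations with stable coefficients, the Lyapunov inequality for a stable
    matrix ([lyapunov_psd]), and the eigenvector forms of controllability and
    observability, tested on explicit exponential trajectories. *)

Set Implicit Arguments.
Unset Strict Implicit.
Unset Printing Implicit Defensive.

Import Order.TTheory GRing.Theory Num.Theory.
Import numFieldNormedType.Exports.

Local Open Scope ring_scope.

(** * Complex eigenvectors of real matrices *)

(** An eigenvector of the matrix of [A] restricted to a basis of the stable row space. *)
Lemma stable_eigenvector (C : numClosedFieldType) (p n : nat)
    (V : 'M[C]_(p, n)) (A : 'M[C]_n) :
  (V *m A <= V)%MS -> V != 0 ->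
  exists (l : C) (v : 'rV[C]_n), [/\ v != 0, (v <= V)%MS & v *m A = l *: v].
Proof.
move=> sVA V0.
have : (row_base V *m A <= row_base V)%MS.
  rewrite eq_row_base; apply: submx_trans sVA.
  by apply: submxMr; rewrite eq_row_base.
case/submxP => L VL.
have rV : (0 < \rank V)%N by rewrite lt0n mxrank_eq0.
have [l /eigenvalueP [w wL w0]] := eigenvalue_closed L rV.
exists l, (w *m row_base V); split.
- by rewrite mulmx_free_eq0 ?row_base_free.
- by apply: submx_trans (submxMl _ _) _; rewrite eq_row_base.
- by rewrite -mulmxA VL mulmxA wL scalemxAl.
Qed.

Lemma char_poly_tr (F : comNzRingType) n (A : 'M[F]_n) :
  char_poly A^T = char_poly A.
Proof.
rewrite /char_poly -[RHS]det_tr; congr (\det _).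
by rewrite /char_poly_mx linearB /= tr_scalar_mx map_trmx.
Qed.

Lemma col_mulmx (K : pzSemiRingType) p q s (X : 'M[K]_(p, q)) (Y : 'M[K]_(q, s)) j :
  col j (X *m Y) = X *m col j Y.
Proof. by apply/matrixP => i k; rewrite !mxE; apply: eq_bigr => l _; rewrite mxE. Qed.

Section RealParts.
Variable R : realType.
Local Notation cmx := (map_mx (real_complex R)).
Local Notation remx := (map_mx (@complex.Re R)).
Local Notation immx := (map_mx (@complex.Im R)).

Lemma Re_sum (I : finType) (f : I -> R[i]) :
  complex.Re (\sum_i f i) = \sum_i complex.Re (f i).
Proof. by elim/big_rec2: _ => //= i y1 y2 _ <-; case: (f i) y2 => a b []. Qed.

Lemma Im_sum (I : finType) (f : I -> R[i]) :
  complex.Im (\sum_i f i) = \sum_i complex.Im (f i).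
Proof. by elim/big_rec2: _ => //= i y1 y2 _ <-; case: (f i) y2 => a b []. Qed.

Lemma remx_mul p q s (X : 'M[R[i]]_(p, q)) (Y : 'M[R[i]]_(q, s)) :
  remx (X *m Y) = remx X *m remx Y - immx X *m immx Y.
Proof.
apply/matrixP => i j; rewrite !mxE Re_sum -sumrB; apply: eq_bigr => k _.
by rewrite !mxE; case: (X i k) (Y k j) => a b [c d].
Qed.

Lemma immx_mul p q s (X : 'M[R[i]]_(p, q)) (Y : 'M[R[i]]_(q, s)) :
  immx (X *m Y) = remx X *m immx Y + immx X *m remx Y.
Proof.
apply/matrixP => i j; rewrite !mxE Im_sum -big_split; apply: eq_bigr => k _.
by rewrite !mxE; case: (X i k) (Y k j) => a b [c d].
Qed.

Lemma remx_real p q (M : 'M[R]_(p, q)) : remx (cmx M) = M.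
Proof. by apply/matrixP => i j; rewrite !mxE. Qed.

Lemma immx_real p q (M : 'M[R]_(p, q)) : immx (cmx M) = 0.
Proof. by apply/matrixP => i j; rewrite !mxE. Qed.

Lemma remx_adj p q (W : 'M[R[i]]_(p, q)) :
  remx (map_mx Num.conj W^T) = (remx W)^T.
Proof. by apply/matrixP => i j; rewrite !mxE; case: (W j i). Qed.

Lemma immx_adj p q (W : 'M[R[i]]_(p, q)) :
  immx (map_mx Num.conj W^T) = - (immx W)^T.
Proof. by apply/matrixP => i j; rewrite !mxE; case: (W j i). Qed.

Lemma remx_mulr p q s (W : 'M[R[i]]_(p, q)) (M : 'M[R]_(q, s)) :
  remx (W *m cmx M) = remx W *m M.
Proof. by rewrite remx_mul remx_real immx_real mulmx0 subr0. Qed.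

Lemma immx_mulr p q s (W : 'M[R[i]]_(p, q)) (M : 'M[R]_(q, s)) :
  immx (W *m cmx M) = immx W *m M.
Proof. by rewrite immx_mul remx_real immx_real mulmx0 add0r. Qed.

Lemma remx_scale p q (l : R[i]) (W : 'M[R[i]]_(p, q)) :
  remx (l *: W) = complex.Re l *: remx W - complex.Im l *: immx W.
Proof.
by apply/matrixP => i j; rewrite !mxE; case: l (W i j) => [a b] [c d] /=.
Qed.

Lemma immx_scale p q (l : R[i]) (W : 'M[R[i]]_(p, q)) :
  immx (l *: W) = complex.Im l *: remx W + complex.Re l *: immx W.
Proof.
apply/matrixP => i j; rewrite !mxE.
by case: l (W i j) => [a b] [c d] /=; ring.
Qed.

Lemma reimx_eq0 p q (W : 'M[R[i]]_(p, q)) : remx W = 0 -> immx W = 0 -> W = 0.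
Proof.
move=> /matrixP h1 /matrixP h2; apply/matrixP => i j.
have := h1 i j; have := h2 i j; rewrite !mxE.
by case: (W i j) => a b /= -> ->.
Qed.

Lemma reimxE p q (W : 'M[R[i]]_(p, q)) i j :
  W i j = Complex (remx W i j) (immx W i j).
Proof. by rewrite !mxE; case: (W i j). Qed.

Lemma adj_real p q (M : 'M[R]_(p, q)) : map_mx Num.conj (cmx M)^T = cmx M^T.
Proof. by apply/matrixP => i j; rewrite !mxE conj_Creal // complex_real. Qed.

Lemma remx_form n (M : 'M[R]_n) (w : 'cV[R[i]]_n) :
  remx (map_mx Num.conj w^T *m cmx M *m w) =
  (remx w)^T *m M *m remx w + (immx w)^T *m M *m immx w.
Proof. by rewrite remx_mul remx_mulr immx_mulr remx_adj immx_adj !mulNmx opprK. Qed.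

Lemma Re_hermitian_form (n : nat) (M : 'M[R]_n) (w : 'cV[R[i]]_n) :
  complex.Re ((map_mx Num.conj w^T *m cmx M *m w) 0 0) =
  ((remx w)^T *m M *m remx w) 0 0 + ((immx w)^T *m M *m immx w) 0 0.
Proof.
by rewrite reimxE remx_form mxE.
Qed.

Lemma hermitian_form_real (n : nat) (M : 'M[R]_n) (w : 'cV[R[i]]_n) :
  M^T = M ->
  (map_mx Num.conj w^T *m cmx M *m w) 0 0 =
  (((remx w)^T *m M *m remx w) 0 0 + ((immx w)^T *m M *m immx w) 0 0)%:C%C.
Proof.
move=> Ms.
have Im_z : immx (map_mx Num.conj w^T *m cmx M *m w) = 0.
  rewrite immx_mul remx_mulr immx_mulr remx_adj immx_adj !mulNmx.
  apply/eqP; rewrite subr_eq0; apply/eqP; rewrite [LHS]mx11_scalar -tr_scalar_mx.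
  by rewrite -mx11_scalar !trmx_mul trmxK Ms mulmxA.
by rewrite reimxE remx_form Im_z [X in Complex X _]mxE [X in Complex _ X]mxE.
Qed.

(** The real form of a complex eigenvector [a + i b], with eigenvalue [al + i be],
    of [A] on the invariant subspace [ker K]. *)
Lemma real_eigenpair (q n : nat) (K : 'M[R]_(q, n)) (A : 'M[R]_n) :
  (forall v : 'cV_n, K *m v = 0 -> K *m (A *m v) = 0) ->
  (exists2 v : 'cV_n, v != 0 & K *m v = 0) ->
  exists (al be : R) (a b : 'cV[R]_n),
    [/\ (a != 0) || (b != 0), K *m a = 0, K *m b = 0,
        A *m a = al *: a - be *: b & A *m b = be *: a + al *: b].
Proof.
move=> KA [v v0 Kv].
pose V := kermx K^T.
have V0 : V != 0.
  apply: contraNneq v0 => V0.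
  have /sub_kermxP : v^T *m K^T = 0 by rewrite -trmx_mul Kv trmx0.
  by rewrite -/V V0 submx0 -trmx0 (inj_eq trmx_inj).
have VA : (V *m A^T <= V)%MS.
  apply/sub_kermxP/row_matrixP => i.
  rewrite row_mul row_mul row0 -[row i V]trmxK -!trmx_mul.
  rewrite KA ?trmx0 //; apply: trmx_inj.
  by rewrite trmx_mul trmxK trmx0 -row_mul mulmx_ker row0.
have cVA : (cmx V *m cmx A^T <= cmx V)%MS by rewrite -map_mxM map_submx.
have [|l [w [w0 wV wA]]] := stable_eigenvector cVA; first by rewrite map_mx_eq0.
have wK : w *m cmx K^T = 0.
  have /submxP [D ->] := wV.
  by rewrite -mulmxA -map_mxM mulmx_ker map_mx0 mulmx0.
exists (complex.Re l), (complex.Im l), (remx w)^T, (immx w)^T.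
have tE (M : 'M[R]_n) (x : 'rV[R]_n) : M *m x^T = (x *m M^T)^T.
  by rewrite trmx_mul trmxK.
split.
- apply: contraNT w0; rewrite negb_or !negbK => /andP[/eqP h1 /eqP h2].
  by apply/eqP/reimx_eq0; apply: trmx_inj; rewrite ?h1 ?h2 trmx0.
- by apply: trmx_inj; rewrite trmx_mul trmxK -remx_mulr wK map_mx0 trmx0.
- by apply: trmx_inj; rewrite trmx_mul trmxK -immx_mulr wK map_mx0 trmx0.
- by rewrite tE -remx_mulr wA remx_scale !linearB !linearZ.
- by rewrite tE -immx_mulr wA immx_scale !linearD !linearZ.
Qed.

End RealParts.

(** * Sylvester equations *)

Section Sylvester.
Variable R : realType.
Local Notation cmx := (map_mx (real_complex R)).

(** If [A *m X = X *m - F^T] and [X] is not zero, its complex row space contains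
    an eigenvector [v *m X] of [- F^T], whose eigenvalue [mu] has a positive real part,
    so that [A - mu] is invertible.  The left kernel of [X] is stable under [A - mu],
    hence equal to its image; it contains [v *m (A - mu)], so it contains [v],
    and the eigenvector vanishes. *)
Lemma sylvester_inj (k l : nat) (A : 'M[R]_k) (F : 'M[R]_l) (X : 'M[R]_(k, l)) :
  asymptotically_stable A -> asymptotically_stable F ->
  A *m X + X *m F^T = 0 -> X = 0.
Proof.
move=> sA sF /eqP; rewrite addr_eq0 -mulmxN => /eqP AX.
apply/eqP; apply: contraT => X0.
have cAX : cmx A *m cmx X = cmx X *m cmx (- F^T) by rewrite -!map_mxM AX.
have cX0 : cmx X != 0 by rewrite map_mx_eq0.
have [|mu [w [w0 /submxP[v wE] wB]]] := @stable_eigenvector _ _ _ _ (cmx (- F^T)) _ cX0.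
  by rewrite -cAX submxMl.
have Fmu : complex.Re (- mu) < 0.
  apply: sF; rewrite eigenvalue_root_char -char_poly_tr map_trmx.
  rewrite -eigenvalue_root_char; apply/eigenvalueP; exists w => //.
  by rewrite scaleNr -wB map_mxN mulmxN opprK.
have uA : cmx A - mu%:M \in unitmx.
  rewrite -row_free_unit -kermx_eq0; apply: contraTT Fmu => ev.
  have /sA : eigenvalue (cmx A) mu by exact: ev.
  by case: (mu) => a b /=; rewrite oppr_lt0 -leNgt => /ltW.
set K := kermx (cmx X).
have KX : K *m cmx X = 0 by exact: mulmx_ker.
have KAX : (K *m (cmx A - mu%:M) <= K)%MS.
  apply/sub_kermxP; rewrite -mulmxA mulmxBl cAX mulmxBr (mulmxA K) KX mul0mx.
  by rewrite mul_scalar_mx -scalemxAr KX scaler0 subr0.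
have KE : (K <= K *m (cmx A - mu%:M))%MS.
  by rewrite -(mxrank_leqif_sup KAX) mxrankMfree // row_free_unit.
have /sub_kermxP : v *m (cmx A - mu%:M) *m cmx X = 0.
  rewrite -mulmxA mulmxBl cAX mulmxBr (mulmxA v) -wE wB.
  by rewrite mul_scalar_mx -scalemxAr -wE subrr.
rewrite -/K => vK; have /submxP [D] := submx_trans vK KE.
rewrite mulmxA => /(can_inj (mulmxK uA)) vE.
by rewrite wE vE -mulmxA KX mulmx0 eqxx in w0.
Qed.

Lemma sylvester_unique (k l m : nat) (A : 'M[R]_k) (B : 'M[R]_(k, m))
    (F : 'M[R]_l) (E : 'M[R]_(l, m)) :
  asymptotically_stable A -> asymptotically_stable F ->
  exists X, unique (sylvester_eq A B F E) X.
Proof.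
move=> sA sF.
pose M := lin_mulmx A + lin_mulmxr F^T : 'M[R]_(k * l, k * l).
have ME (X : 'M[R]_(k, l)) : mxvec X *m M = mxvec (A *m X + X *m F^T).
  by rewrite mulmxDr !mul_vec_lin linearD.
have uM : M \in unitmx.
  rewrite -row_free_unit -kermx_eq0; apply/eqP/row_matrixP => i.
  rewrite row0 -[row i _]vec_mxK -[RHS](linear0 mxvec); congr mxvec.
  apply: (sylvester_inj sA sF); apply: (can_inj mxvecK).
  by rewrite -ME vec_mxK linear0 -row_mul mulmx_ker row0.
exists (vec_mx (mxvec (- (B *m E^T)) *m invmx M)); split.
  rewrite /sylvester_eq; apply/eqP; rewrite addr_eq0; apply/eqP.
  by apply: (can_inj mxvecK); rewrite -ME vec_mxK mulmxKV.
move=> Y /eqP; rewrite addr_eq0 => /eqP <-.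
by rewrite -ME mulmxK // mxvecK.
Qed.

End Sylvester.

(** * The Lyapunov inequality *)

Section Lyapunov.
Variable C : numClosedFieldType.
Local Open Scope sesquilinear_scope.

Lemma adj_mul p q s (X : 'M[C]_(p, q)) (Y : 'M[C]_(q, s)) :
  (X *m Y)^t* = Y^t* *m X^t*.
Proof. by rewrite trmx_mul map_mxM. Qed.

Lemma adj_add p q (X Y : 'M[C]_(p, q)) : (X + Y)^t* = X^t* + Y^t*.
Proof. by rewrite linearD map_mxD. Qed.

Lemma adj_scale p q a (X : 'M[C]_(p, q)) : (a *: X)^t* = a^* *: X^t*.
Proof. by apply/matrixP => i j; rewrite !mxE rmorphM. Qed.

Lemma adj_col p q s (X : 'M[C]_(p, s)) (Y : 'M[C]_(q, s)) :
  (col_mx X Y)^t* = row_mx (X^t*) (Y^t*).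
Proof. by rewrite tr_col_mx map_row_mx. Qed.

Lemma adj_block p q s t (X : 'M[C]_(p, s)) (Y : 'M[C]_(p, t))
    (Z : 'M[C]_(q, s)) (U : 'M[C]_(q, t)) :
  (block_mx X Y Z U)^t* = block_mx (X^t*) (Z^t*) (Y^t*) (U^t*).
Proof. by rewrite tr_block_mx map_block_mx. Qed.

Lemma adj_zero p q : (0 : 'M[C]_(p, q))^t* = 0.
Proof. by rewrite trmx0 map_mx0. Qed.

Lemma adj_self_ge0 p (z : 'cV[C]_p) : 0 <= (z^t* *m z) 0 0.
Proof. by rewrite !mxE sumr_ge0 // => i _; rewrite !mxE mulrC mul_conjC_ge0. Qed.

Lemma adj_self_eq0 p (z : 'cV[C]_p) : (z^t* *m z) 0 0 = 0 -> z = 0.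
Proof.
rewrite mxE => /eqP; rewrite psumr_eq0 => [/allP h|i _]; last first.
  by rewrite !mxE mulrC mul_conjC_ge0.
apply/matrixP => i j; rewrite (ord1 j) !mxE; apply/eqP.
have := h i; rewrite mem_index_enum => /(_ isT) /=.
by rewrite !mxE mulrC mul_conjC_eq0.
Qed.

Lemma addJ_lt0 (z : C) : 'Re z < 0 -> z + z^* < 0.
Proof. by rewrite ReE pmulr_llt0 // invr_gt0. Qed.

Lemma lyapunov_form n (T P : 'M[C]_n) (v : 'cV_n) : P^t* = P ->
  (v^t* *m (T *m P + P *m T^t*) *m v) 0 0 =
    (v^t* *m (T *m (P *m v))) 0 0 + ((v^t* *m (T *m (P *m v))) 0 0)^*.
Proof.
move=> Ph.
have -> : ((v^t* *m (T *m (P *m v))) 0 0)^* = ((v^t* *m (T *m (P *m v)))^t*) 0 0.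
  by rewrite !mxE.
by rewrite !adj_mul Ph trmxCK mulmxDr mulmxDl !mulmxA mxE.
Qed.

Lemma lyapunov_unitary n (U A P : 'M[C]_n) : U^t* *m U = 1%:M ->
  (U *m A *m U^t*) *m (U *m P *m U^t*) + (U *m P *m U^t*) *m (U *m A *m U^t*)^t* =
  U *m (A *m P + P *m A^t*) *m U^t*.
Proof.
move=> UU; have e X Y : (U *m X *m U^t*) *m (U *m Y *m U^t*) = U *m (X *m Y) *m U^t*.
  by rewrite !mulmxA -(mulmxA (U *m X)) UU mulmx1.
have -> : (U *m A *m U^t*)^t* = U *m A^t* *m U^t* by rewrite !adj_mul trmxCK mulmxA.
by rewrite !e mulmxDr mulmxDl.
Qed.

Lemma unitary_form n (U P : 'M[C]_n) (v : 'cV[C]_n) : U^t* *m U = 1%:M ->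
  (U *m v)^t* *m (U *m P *m U^t*) *m (U *m v) = v^t* *m P *m v.
Proof.
move=> UU; rewrite adj_mul !mulmxA -(mulmxA (v^t*)) UU mulmx1.
by rewrite -(mulmxA (v^t* *m P)) UU mulmx1.
Qed.

(** Induction on the size, by a Schur complement.  The leading entry [s] of [P] is
    nonnegative because the leading entry of the inequality is [2 Re x * s].  If
    [s = 0], the first column of the inequality must vanish as well, which reads
    [(A + conj x) p = 0] for the rest [p] of the first column of [P], and [p = 0]
    since [A + conj x] is triangular with a nonzero diagonal.  In all cases the Schur
    complement [S] of [s] in [P] satisfies the inequality for [A]: a vector [v]
    lifts to [y v] with [P *m y v = (0, S *m v)]. *)
Lemma lyapunov_trig n (T : 'M[C]_n) : is_trig_mx T ->
  (forall i, 'Re (T i i) < 0) ->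
  forall P : 'M[C]_n, P^t* = P ->
    (forall v : 'cV_n, (v^t* *m (T *m P + P *m T^t*) *m v) 0 0 <= 0) ->
    forall v : 'cV_n, 0 <= (v^t* *m P *m v) 0 0.
Proof.
elim/trigsqmx_ind=> {n T} [|n x c A tA IH] dT P Ph W.
  by move=> v; rewrite (flatmx0 v) mulmx0 mxE.
have dA i : 'Re (A i i) < 0.
  by have := dT (rshift 1 i); rewrite block_mxEdr.
have dx : 'Re (x 0 0) < 0 by have := dT (lshift n 0); rewrite block_mxEul.
pose s := (ulsubmx P) 0 0; pose p := dlsubmx P; pose P1 := drsubmx P.
have PE : P = block_mx s%:M (p^t*) p P1.
  rewrite -[P](@submxK _ 1 n 1 n); congr block_mx => //.
    by rewrite [LHS]mx11_scalar.
  by rewrite -[in LHS]Ph -{1}[P](@submxK _ 1 n 1 n) adj_block block_mxKur.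
have P1h : P1^t* = P1.
  by rewrite /P1 -[in RHS]Ph -{2}[P](@submxK _ 1 n 1 n) adj_block block_mxKdr.
have sh : s^* = s.
  by rewrite /s -[in RHS]Ph -{2}[P](@submxK _ 1 n 1 n) adj_block block_mxKul !mxE.
rewrite (mx11_scalar x) in W *; set x0 := x 0 0 in dx W *.
set T := block_mx _ _ _ _ in W.
have f_le0 (v : 'cV_(1 + n)) :
    (v^t* *m (T *m (P *m v))) 0 0 + ((v^t* *m (T *m (P *m v))) 0 0)^* <= 0.
  by have := W v; rewrite lyapunov_form.
have s_ge0 : 0 <= s.
  have := f_le0 (col_mx 1%:M 0).
  rewrite PE mul_block_col !mulmx1 !mulmx0 !addr0 mul_block_col mul0mx addr0.
  rewrite adj_col mul_row_col adj_zero mul0mx addr0 tr_scalar_mx map_scalar_mx.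
  rewrite -!scalar_mxM !mxE /= !mulr1n rmorph1 mul1r rmorphM /= sh -mulrDl.
  by rewrite nmulr_rle0 // addJ_lt0.
have p0 : s = 0 -> p = 0.
  move=> s0.
  pose M := A + x0^*%:M.
  have uM : M \in unitmx.
    have tM : is_trig_mx M.
      apply/is_trig_mxP => i j ij; rewrite !mxE (is_trig_mxP tA) //.
      by rewrite (ltn_eqF ij : (i == j) = false) mulr0n addr0.
    rewrite unitmxE det_trig // unitfE; apply/prodf_neq0 => i _.
    apply/eqP => /(congr1 (fun z => 'Re z)); rewrite !mxE eqxx mulr1n raddfD /=.
    rewrite Re_conj raddf0 => h.
    by have := ltrD (dA i) dx; rewrite h addr0 ltxx.
  pose u := M *m p; pose k := (u^t* *m u) 0 0.
  suff k0 : k = 0 by rewrite -(mulKmx uM p) -/u (adj_self_eq0 k0) mulmx0.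
  pose a1 := (u^t* *m (A *m p)) 0 0; pose a2 := (p^t* *m u) 0 0.
  pose be := (u^t* *m (c *m (p^t* *m u) + A *m (P1 *m u))) 0 0.
  have kE : k = a1 + x0^* * a2^*.
    rewrite /k {2}/u /M mulmxDl mulmxDr mxE -/a1; congr (_ + _).
    rewrite mul_scalar_mx -scalemxAr mxE; congr (_ * _).
    have -> : a2^* = ((p^t* *m u)^t*) 0 0 by rewrite /a2 !mxE.
    by rewrite adj_mul trmxCK.
  have k_real : k^* = k by apply/CrealP/ger0_real/adj_self_ge0.
  (* The inequality tested at [(t, u)] is affine in the real number [t], with slope
     twice the squared norm of [u]. *)
  have key t : t^* = t -> t * (k + k) + (be + be^*) <= 0.
    move=> tr; have := f_le0 (col_mx t%:M u).
    rewrite PE s0 mul_block_col raddf0 mul0mx add0r mul_block_col mul0mx addr0.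
    rewrite adj_col mul_row_col tr_scalar_mx map_scalar_mx /= tr.
    have -> : t%:M *m (x0%:M *m (p^t* *m u)) +
        u^t* *m (c *m (p^t* *m u) + A *m (p *m t%:M + P1 *m u)) =
        t *: (x0 *: (p^t* *m u) + u^t* *m (A *m p)) +
        u^t* *m (c *m (p^t* *m u) + A *m (P1 *m u)).
      rewrite !mul_scalar_mx mul_mx_scalar !mulmxDr -!scalemxAr scalerDr.
      by rewrite -addrA; congr (_ + _); rewrite addrCA.
    have -> : (t *: (x0 *: (p^t* *m u) + u^t* *m (A *m p)) +
        u^t* *m (c *m (p^t* *m u) + A *m (P1 *m u))) 0 0 =
        t * (x0 * a2 + a1) + be.
      by rewrite /be /a1 /a2 mxE; congr (_ + _); rewrite mxE; congr (_ * _); rewrite 2!mxE.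
    rewrite !(rmorphD, rmorphM) /= tr => h.
    have kE2 : k = a1^* + x0 * a2 by rewrite -k_real kE rmorphD rmorphM /= !conjCK.
    by apply: le_trans h; rewrite {1}kE kE2 le_eqVlt; apply/orP; left; apply/eqP; ring.
  apply/eqP; apply: contraT => k0.
  have b_real : (be + be^*)^* = be + be^* by rewrite rmorphD /= conjCK addrC.
  have := key ((1 - (be + be^*)) / (k + k)).
  rewrite !(fmorph_div, rmorphB, rmorph1) /= b_real [(k + k)^*]rmorphD /= k_real.
  move=> /(_ erefl); rewrite divfK; last by rewrite -mulr2n mulrn_eq0.
  by rewrite subrK ler10.
(* When [s = 0], also [p = 0], and the formula still gives the Schur complement. *)
pose S := P1 - s^-1 *: (p *m p^t*).
have Sh : S^t* = S.
  have sVh : (- s^-1)^* = - s^-1 by rewrite rmorphN fmorphV /= sh.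
  by rewrite /S -scaleNr adj_add adj_scale adj_mul trmxCK P1h sVh.
pose y (v : 'cV_n) := col_mx (- s^-1 *: (p^t* *m v)) v.
have Py v : P *m y v = col_mx 0 (S *m v).
  rewrite PE mul_block_col mul_scalar_mx scalerA mulrN.
  have [s0|s0] := eqVneq s 0.
    by rewrite /S p0 // adj_zero !mul0mx !scaler0 !addr0 add0r subr0.
  rewrite divff // scaleN1r addNr; congr col_mx.
  by rewrite -scalemxAr mulmxA /S mulmxBl -scalemxAl scaleNr addrC.
have Sf (v : 'cV_n) : (v^t* *m S *m v) 0 0 = ((y v)^t* *m P *m y v) 0 0.
  by rewrite -!mulmxA Py adj_col mul_row_col mulmx0 add0r.
have Sge0 : forall v : 'cV_n, 0 <= (v^t* *m S *m v) 0 0.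
  apply: IH => // v; rewrite lyapunov_form //.
  have := f_le0 (y v); rewrite Py mul_block_col !mulmx0 !mul0mx !add0r.
  by rewrite adj_col mul_row_col mulmx0 add0r.
move=> v; pose v1 := dsubmx (v : 'cV_(1 + n)).
pose e : 'cV_(1 + n) := col_mx (usubmx (v : 'cV_(1 + n)) + s^-1 *: (p^t* *m v1)) 0.
have vE : v = y v1 + e.
  by rewrite /y /e add_col_mx addr0 scaleNr addrC addrK vsubmxK.
have ePy : e^t* *m P *m y v1 = 0.
  by rewrite -mulmxA Py adj_col mul_row_col mulmx0 add0r adj_zero mul0mx.
have yPe : (y v1)^t* *m P *m e = 0.
  have := congr1 (fun M => M^t*) ePy.
  by rewrite /= adj_zero 2!adj_mul trmxCK Ph mulmxA.
have -> : v^t* *m P *m v = (y v1)^t* *m P *m y v1 + e^t* *m P *m e.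
  by rewrite vE adj_add !mulmxDl !mulmxDr ePy yPe addr0 add0r.
rewrite mxE addr_ge0 //; first by rewrite -Sf.
rewrite /e PE -mulmxA mul_block_col !mulmx0 !addr0 adj_col mul_row_col adj_zero.
rewrite mul0mx addr0 mul_scalar_mx -scalemxAr mxE.
by rewrite mulr_ge0 // adj_self_ge0.
Qed.

End Lyapunov.

Section RealLyapunov.
Variable R : realType.
Local Notation cmx := (map_mx (real_complex R)).
Local Notation remx := (map_mx (@complex.Re R)).
Local Notation immx := (map_mx (@complex.Im R)).
Local Open Scope sesquilinear_scope.

(** A unitary change of coordinates makes [A] triangular over the complex numbers. *)
Lemma lyapunov_psd (n : nat) (A P : 'M[R]_n) :
  asymptotically_stable A -> P^T = P ->
  (forall v : 'cV_n, (v^T *m (A *m P + P *m A^T) *m v) 0 0 <= 0) -> psdmx P.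
Proof.
move=> sA Ps W; split=> // x.
case: n A P sA Ps W x => [|n] A P sA Ps W x.
  by rewrite [x]flatmx0 mulmx0 mxE.
have n_gt0 := ltn0Sn n; have [U uU] := Schur (cmx A) n_gt0.
move=> tT0; have tT : is_trig_mx (conjmx U (cmx A)) by exact: tT0.
move: tT; rewrite conjymx // => tT.
set T := U *m _ *m _ in tT.
have UU : U^t* *m U = 1%:M by apply: mulmx1C; apply/unitarymxP.
have dT i : 'Re (T i i) < 0.
  have : eigenvalue (cmx A) (T i i).
    have : eigenvalue T (T i i).
      rewrite eigenvalue_root_char char_poly_trig // rootE (bigD1 i) //=.
      by rewrite hornerM hornerXsubC subrr mul0r.
    case/eigenvalueP => v vT v0; apply/eigenvalueP; exists (v *m U).
      by rewrite scalemxAl -vT /T -!mulmxA UU mulmx1.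
    apply: contraNneq v0 => vU.
    by rewrite -[v]mulmx1 -(unitarymxP uU) mulmxA vU mul0mx.
  move/sA => Re0; rewrite ReE.
  case: (T i i) Re0 => a b /= a0.
  rewrite pmulr_llt0 ?invr_gt0 // ltcE /= subrr eqxx /=.
  by rewrite -mulr2n pmulrn_llt0.
have Ph : (U *m cmx P *m U^t*)^t* = U *m cmx P *m U^t*.
  by rewrite !adj_mul trmxCK adj_real Ps mulmxA.
have := lyapunov_trig tT dT Ph.
rewrite lyapunov_unitary // adj_real -!map_mxM -map_mxD => psd.
have {}psd : forall v : 'cV_n.+1,
    0 <= (v^t* *m (U *m cmx P *m U^t*) *m v) 0 0.
  apply: psd => v.
  have -> : v^t* *m (U *m cmx (A *m P + P *m A^T) *m U^t*) *m v =
     (U^t* *m v)^t* *m cmx (A *m P + P *m A^T) *m (U^t* *m v).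
    by rewrite adj_mul trmxCK !mulmxA.
  rewrite hermitian_form_real; last first.
    by rewrite linearD /= !trmx_mul trmxK Ps addrC.
  rewrite lecE /= eqxx /=.
  by have := lerD (W (remx (U^t* *m v))) (W (immx (U^t* *m v))); rewrite addr0.
have := psd (U *m cmx x).
rewrite unitary_form // hermitian_form_real // remx_real immx_real mulmx0 [X in _ + X]mxE addr0.
by rewrite ler0c.
Qed.

Lemma stable_tr n (A : 'M[R]_n) : asymptotically_stable A -> asymptotically_stable A^T.
Proof.
move=> sA l; rewrite eigenvalue_root_char -map_trmx char_poly_tr => h.
by apply: sA; rewrite eigenvalue_root_char.
Qed.

End RealLyapunov.

(** * Positive semidefinite matrices *)

Section RealForms.
Variable R : realType.

Lemma form_tr (n : nat) (M : 'M[R]_n) (x y : 'cV[R]_n) :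
  (x^T *m M *m y) 0 0 = (y^T *m M^T *m x) 0 0.
Proof.
have <- : (x^T *m M *m y)^T 0 0 = (x^T *m M *m y) 0 0 by rewrite mxE.
by rewrite !trmx_mul trmxK mulmxA.
Qed.

Lemma sqn_ge0 (n : nat) (x : 'cV[R]_n) : 0 <= (x^T *m x) 0 0.
Proof. by rewrite mxE sumr_ge0 // => i _; rewrite mxE -expr2 sqr_ge0. Qed.

Lemma sqn_eq0 (n : nat) (x : 'cV[R]_n) : (x^T *m x) 0 0 = 0 -> x = 0.
Proof.
rewrite mxE => /eqP; rewrite psumr_eq0 => [/allP h|i _]; last first.
  by rewrite mxE -expr2 sqr_ge0.
apply/matrixP => i j; rewrite (ord1 j) !mxE; apply/eqP.
have := h i; rewrite mem_index_enum => /(_ isT) /=.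
by rewrite mxE mulf_eq0 orbb.
Qed.

Lemma psd_add n (M N : 'M[R]_n) : psdmx M -> psdmx N -> psdmx (M + N).
Proof.
move=> [Ms M0] [Ns N0]; split=> [|v]; first by rewrite linearD /= Ms Ns.
by rewrite mulmxDr mulmxDl mxE addr_ge0.
Qed.

Lemma psd_scale n (M : 'M[R]_n) t : 0 <= t -> psdmx M -> psdmx (t *: M).
Proof.
move=> t0 [Ms M0]; split=> [|v]; first by rewrite linearZ /= Ms.
by rewrite -scalemxAr -scalemxAl mxE mulr_ge0.
Qed.

Lemma psd_zero n : psdmx (0 : 'M[R]_n).
Proof. by split=> [|v]; [rewrite trmx0 | rewrite mulmx0 mul0mx mxE]. Qed.

Lemma psd_outer n (v : 'cV[R]_n) : psdmx (v *m v^T).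
Proof.
split=> [|u]; first by rewrite trmx_mul trmxK.
suff -> : u^T *m (v *m v^T) *m u = (v^T *m u)^T *m (v^T *m u) by exact: sqn_ge0.
by rewrite trmx_mul trmxK !mulmxA.
Qed.

(** The form is nonnegative at [v + t *: (M *m v)], where it has no constant term in [t]. *)
Lemma psd_kernel (n : nat) (M : 'M[R]_n) (v : 'cV[R]_n) :
  psdmx M -> (v^T *m M *m v) 0 0 = 0 -> M *m v = 0.
Proof.
move=> [Ms M0] v0; set u := M *m v; apply: sqn_eq0.
set k := (u^T *m u) 0 0; have k0 : 0 <= k := sqn_ge0 u.
set q := (u^T *m M *m u) 0 0; have q0 : 0 <= q := M0 u.
have e t : ((v + t *: u)^T *m M *m (v + t *: u)) 0 0 = t * (k + k) + t ^+ 2 * q.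
  have uv : (u^T *m M *m v) 0 0 = k by rewrite -mulmxA.
  have vu : (v^T *m M *m u) 0 0 = k by rewrite form_tr Ms.
  have -> : (v + t *: u)^T = v^T + t *: u^T by rewrite linearD linearZ.
  rewrite !mulmxDl !mulmxDr -!scalemxAl -!scalemxAr.
  rewrite !scalerA mxE [X in X + _]mxE [X in _ + X]mxE v0 add0r.
  rewrite [X in X + _]mxE vu [X in _ + (X + _)]mxE uv [X in _ + (_ + X)]mxE -/q.
  by ring.
(* The vertex of the parabola is at [- k / q]; [1 + q] avoids the case [q = 0]. *)
have := M0 (v + (- (k / (1 + q))) *: u); rewrite e => h.
have q1 : 0 < 1 + q by lra.
have {h} : 0 <= k * (- (k + k) + k / (1 + q) * q) / (1 + q).
  by apply: le_trans h _; rewrite le_eqVlt; apply/orP; left; apply/eqP; ring.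
rewrite pmulr_lge0 ?invr_gt0 // => h.
apply/eqP; rewrite eq_le k0 andbT leNgt; apply/negP => kp.
move: h; rewrite pmulr_rge0 //; apply/negP; rewrite -ltNge.
have : k / (1 + q) * q <= k by rewrite mulrAC ler_pdivrMr // ler_wpM2l //; lra.
by lra.
Qed.

Lemma psd_inj_pd n (M : 'M[R]_n) :
  psdmx M -> (forall v : 'cV_n, M *m v = 0 -> v = 0) -> pdmx M.
Proof.
move=> psdM Minj; have [Ms M0] := psdM; split=> // x x0.
rewrite lt_def M0 andbT; apply: contraNneq x0 => /(psd_kernel psdM)/Minj ->.
exact: eqxx.
Qed.

(** A Cholesky factorization that drops the zero pivots, so that the factor has a
    trivial kernel whatever the rank of [P].  When a pivot [s] is zero, so is the
    rest [p] of its column. *)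
Lemma psd_factor (n : nat) (P : 'M[R]_n) : psdmx P ->
  exists (k : nat) (G : 'M[R]_(n, k)),
    P = G *m G^T /\ forall z : 'cV_k, G *m z = 0 -> z = 0.
Proof.
elim: n P => [|n IH].
  by move=> P _; exists 0%N, 0; split=> [|z _]; apply/matrixP => -[].
rewrite -[n.+1]/(1 + n)%N => P psdP.
have [Ps P_ge0] := psdP.
pose s := (@ulsubmx _ 1 n 1 n P) 0 0; pose p := @dlsubmx _ 1 n 1 n P.
pose P1 := @drsubmx _ 1 n 1 n P.
have PE : P = block_mx s%:M p^T p P1.
  rewrite -[LHS](@submxK _ 1 n 1 n); congr block_mx.
    by rewrite [LHS]mx11_scalar.
  by rewrite -{1}Ps -{1}[P](@submxK _ 1 n 1 n) tr_block_mx block_mxKur.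
have P1s : P1^T = P1.
  by rewrite /P1 -[in RHS]Ps -{2}[P](@submxK _ 1 n 1 n) tr_block_mx block_mxKdr.
pose e : 'cV[R]_(1 + n) := col_mx 1%:M 0.
have Pe : P *m e = col_mx s%:M p.
  by rewrite PE mul_block_col !mulmx0 !addr0 !mulmx1.
have ePe : (e^T *m P *m e) 0 0 = s.
  by rewrite -mulmxA Pe tr_col_mx mul_row_col trmx0 mul0mx addr0 trmx1 mul1mx mxE eqxx mulr1n.
have s_ge0 : 0 <= s by rewrite -ePe P_ge0.
have p0 : s = 0 -> p = 0.
  rewrite -ePe => /(psd_kernel psdP).
  by rewrite Pe -[0]vsubmxK => /eq_col_mx[_ ->]; rewrite linear0.
pose S := P1 - s^-1 *: (p *m p^T).
have Ss : S^T = S by rewrite /S linearB linearZ /= trmx_mul trmxK P1s.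
pose y (v : 'cV_n) : 'cV[R]_(1 + n) := col_mx (- s^-1 *: (p^T *m v)) v.
have Py v : P *m y v = col_mx 0 (S *m v).
  rewrite PE mul_block_col mul_scalar_mx scalerA mulrN.
  have [s0|s0] := eqVneq s 0.
    by rewrite /S p0 // trmx0 !mul0mx !scaler0 !addr0 add0r subr0.
  rewrite divff // scaleN1r addNr; congr col_mx.
  by rewrite -scalemxAr mulmxA /S mulmxBl -scalemxAl scaleNr addrC.
have [|k [G1 [SE G1inj]]] := IH S.
  split=> // v; have := P_ge0 (y v).
  by rewrite -!mulmxA Py tr_col_mx mul_row_col mulmx0 add0r.
have [s0|s0] := eqVneq s 0.
  exists k, (col_mx (0 : 'rV[R]_k) G1); split.
    rewrite PE tr_col_mx mul_col_row -SE /S s0 p0 // !trmx0 !(mulmx0, mul0mx).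
    by rewrite scaler0 subr0 raddf0.
  move=> z; rewrite mul_col_mx.
  by rewrite -[X in _ = X](@vsubmxK _ 1 n) !linear0 => /eq_col_mx[_]; exact: G1inj.
have r0 : Num.sqrt s != 0 by rewrite sqrtr_eq0 -ltNge lt_def s0.
have rr : Num.sqrt s * Num.sqrt s = s by rewrite -expr2 sqr_sqrtr.
set t := Num.sqrt s in r0 rr.
exists (1 + k)%N, (block_mx t%:M 0 (t^-1 *: p) G1); split.
  rewrite PE tr_block_mx mulmx_block tr_scalar_mx linearZ /= trmx0.
  rewrite !(mulmx0, mul0mx) !addr0 -SE -scalar_mxM rr; congr block_mx.
  - by rewrite mul_scalar_mx scalerA divff // scale1r.
  - by rewrite mul_mx_scalar scalerA divff // scale1r.
  - by rewrite -scalemxAl -scalemxAr scalerA -invfM rr /S addrC subrK.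
move=> z; rewrite -[z](@vsubmxK _ 1 k) mul_block_col mul0mx addr0.
rewrite -[X in _ = X](@vsubmxK _ 1 n) !linear0 => /eq_col_mx [].
rewrite mul_scalar_mx => /eqP; rewrite scaler_eq0 (negPf r0) /= => /eqP ->.
by rewrite mulmx0 add0r => /G1inj ->; rewrite col_mx0.
Qed.

Lemma inj_left_inverse (n k : nat) (G : 'M[R]_(n, k)) :
  (forall z : 'cV_k, G *m z = 0 -> z = 0) -> exists Z : 'M[R]_(k, n), Z *m G = 1%:M.
Proof.
move=> Ginj; suff rf : row_free G^T.
  by exists (pinvmx G^T)^T; apply: trmx_inj; rewrite trmx_mul trmxK trmx1 mulmxVp.
rewrite -kermx_eq0; apply/eqP/row_matrixP => i; rewrite row0; apply: trmx_inj.
rewrite trmx0; apply: Ginj; apply: trmx_inj.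
by rewrite trmx_mul trmxK trmx0 -row_mul mulmx_ker row0.
Qed.

Lemma trace_form_sum (n k : nat) (M : 'M[R]_n) (G : 'M[R]_(n, k)) :
  \tr (M *m (G *m G^T)) = \sum_j ((col j G)^T *m M *m col j G) 0 0.
Proof.
rewrite mulmxA mxtrace_mulC mulmxA; apply: eq_bigr => j _.
by rewrite tr_col -!mulmxA !mxE; apply: eq_bigr => i _; rewrite -col_mulmx !mxE.
Qed.

Lemma trace_psd_ge0 (n : nat) (M X : 'M[R]_n) :
  psdmx X -> (forall u : 'cV_n, 0 <= (u^T *m M *m u) 0 0) -> 0 <= \tr (M *m X).
Proof.
move=> /psd_factor[k [G [-> _]]] M0.
by rewrite trace_form_sum sumr_ge0.
Qed.

End RealForms.

(** * Frobenius inner product and elements of least norm *)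

Section Projection.
Variable R : realType.
Local Open Scope classical_set_scope.

Lemma cvg_sumr (T I : Type) (F : set_system T) (FF : Filter F)
    (s : seq I) (u : I -> T -> R) (l : I -> R) :
  (forall i, u i x @[x --> F] --> l i) ->
  \sum_(i <- s) u i x @[x --> F] --> \sum_(i <- s) l i.
Proof. by move=> ul; apply: cvg_big => [|i _]; [exact: add_continuous|exact: ul]. Qed.

Definition fro (p q : nat) (X Y : 'M[R]_(p, q)) : R := \tr (X^T *m Y).

Lemma froE p q (X Y : 'M[R]_(p, q)) : fro X Y = \sum_j \sum_i X i j * Y i j.
Proof.
by apply: eq_bigr => j _; rewrite mxE; apply: eq_bigr => i _; rewrite mxE.
Qed.

Lemma froC p q (X Y : 'M[R]_(p, q)) : fro X Y = fro Y X.
Proof. by rewrite /fro -mxtrace_tr trmx_mul trmxK. Qed.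

Lemma froDr p q (X Y Z : 'M[R]_(p, q)) : fro X (Y + Z) = fro X Y + fro X Z.
Proof. by rewrite /fro mulmxDr mxtraceD. Qed.

Lemma froZr p q (X Y : 'M[R]_(p, q)) a : fro X (a *: Y) = a * fro X Y.
Proof. by rewrite /fro -scalemxAr mxtraceZ. Qed.

Lemma froDl p q (X Y Z : 'M[R]_(p, q)) : fro (Y + Z) X = fro Y X + fro Z X.
Proof. by rewrite froC froDr !(froC X). Qed.

Lemma froZl p q (X Y : 'M[R]_(p, q)) a : fro (a *: Y) X = a * fro Y X.
Proof. by rewrite froC froZr froC. Qed.

Lemma froNr p q (X Y : 'M[R]_(p, q)) : fro X (- Y) = - fro X Y.
Proof. by rewrite -scaleN1r froZr mulN1r. Qed.

Lemma froNl p q (X Y : 'M[R]_(p, q)) : fro (- Y) X = - fro Y X.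
Proof. by rewrite froC froNr froC. Qed.

Lemma fro_tr p q (X Y : 'M[R]_(p, q)) : fro X^T Y^T = fro X Y.
Proof. by rewrite /fro trmxK -[RHS]mxtrace_tr trmx_mul trmxK mxtrace_mulC. Qed.

Lemma fro_outer n (M : 'M[R]_n) (v : 'cV[R]_n) :
  fro M (v *m v^T) = (v^T *m M *m v) 0 0.
Proof.
rewrite /fro mulmxA mxtrace_mulC -mxtrace_tr mulmxA.
by rewrite !trmx_mul !trmxK -mulmxA trace_mx11 mulmxA.
Qed.

Lemma fro_ge0 p q (X : 'M[R]_(p, q)) : 0 <= fro X X.
Proof.
by rewrite froE sumr_ge0 // => j _; rewrite sumr_ge0 // => i _; rewrite -expr2 sqr_ge0.
Qed.

Lemma sqr_entry_le_fro p q (X : 'M[R]_(p, q)) i j : X i j ^+ 2 <= fro X X.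
Proof.
rewrite froE (bigD1 j) //= (bigD1 i) //= -expr2 -addrA lerDl addr_ge0 //.
  by rewrite sumr_ge0 // => k _; rewrite -expr2 sqr_ge0.
by rewrite sumr_ge0 // => k _; rewrite sumr_ge0 // => l _; rewrite -expr2 sqr_ge0.
Qed.

Lemma fro_eq0 p q (X : 'M[R]_(p, q)) : fro X X = 0 -> X = 0.
Proof.
move=> X0; apply/matrixP => i j; rewrite mxE; apply/eqP.
by rewrite -sqrf_eq0 eq_le sqr_ge0 -X0 sqr_entry_le_fro.
Qed.

(** Cauchy-Schwarz. *)
Lemma fro_CS p q (X Y : 'M[R]_(p, q)) : fro X Y ^+ 2 <= fro X X * fro Y Y.
Proof.
have [Y0|Y0] := eqVneq (fro Y Y) 0.
  by rewrite (fro_eq0 Y0) -(scale0r Y) !froZr !mul0r expr0n mulr0.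
have Yp : 0 < fro Y Y by rewrite lt_def Y0 fro_ge0.
have := fro_ge0 (fro Y Y *: X - fro X Y *: Y).
rewrite !(froDl, froDr, froNl, froNr, froZl, froZr) (froC Y X) => h.
rewrite -(ler_pM2l Yp) -subr_ge0; apply: le_trans h _.
by rewrite le_eqVlt; apply/orP; left; apply/eqP; ring.
Qed.

(** The Frobenius norm dominates the operator norm. *)
Lemma form_le_fro n (M : 'M[R]_n) (v : 'cV[R]_n) (eta : R) : 0 <= eta ->
  fro M M <= eta ^+ 2 -> (v^T *m M *m v) 0 0 <= eta * (v^T *m v) 0 0.
Proof.
move=> eta0 Mle; have := fro_CS M (v *m v^T).
rewrite !fro_outer; set x := (v^T *m v) 0 0.
have -> : (v^T *m (v *m v^T) *m v) 0 0 = x ^+ 2.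
  by rewrite -!mulmxA mulmxA [LHS]mxE big_ord1 expr2.
have x0 : 0 <= x := sqn_ge0 v => h.
have : (v^T *m M *m v) 0 0 ^+ 2 <= (eta * x) ^+ 2.
  by rewrite exprMn; apply: le_trans h _; rewrite ler_wpM2r // sqr_ge0.
case: (lerP ((v^T *m M *m v) 0 0) 0) => [h1 _|/ltW h1].
  by apply: le_trans h1 _; rewrite mulr_ge0.
by rewrite ler_pXn2r // ?nnegrE // mulr_ge0.
Qed.

(** Cauchy-Schwarz for each row of [X] against each column of [Y]. *)
Lemma fro_mulmx p q s (X : 'M[R]_(p, q)) (Y : 'M[R]_(q, s)) :
  fro (X *m Y) (X *m Y) <= fro X X * fro Y Y.
Proof.
have fro_cV (u : 'cV[R]_q) : fro u u = \sum_i u i 0 ^+ 2.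
  by rewrite froE big_ord1; apply: eq_bigr => i _; rewrite expr2.
have -> : fro X X = \sum_i fro (row i X)^T (row i X)^T.
  rewrite froE exchange_big; apply: eq_bigr => i _; rewrite fro_cV.
  by apply: eq_bigr => j _; rewrite !mxE expr2.
have -> : fro Y Y = \sum_j fro (col j Y) (col j Y).
  rewrite froE; apply: eq_bigr => i _; rewrite fro_cV.
  by apply: eq_bigr => j _; rewrite !mxE expr2.
rewrite froE mulr_sumr; apply: ler_sum => j _; rewrite mulr_suml.
apply: ler_sum => i _; apply: le_trans (fro_CS _ _).
rewrite -expr2 /fro trmxK trace_mx11 !mxE le_eqVlt; apply/orP; left; apply/eqP.
by congr (_ ^+ 2); apply: eq_bigr => k _; rewrite !mxE.
Qed.

Lemma parallelogram p q (X Y : 'M[R]_(p, q)) :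
  fro (X - Y) (X - Y) =
  2 * fro X X + 2 * fro Y Y - 4 * fro (2^-1 *: (X + Y)) (2^-1 *: (X + Y)).
Proof. by rewrite !(froDl, froDr, froNl, froNr, froZl, froZr); field. Qed.

Lemma cvgn_fro p q (X Y : nat -> 'M[R]_(p, q)) (E F : 'M[R]_(p, q)) :
  (forall i j, X n i j @[n --> \oo] --> E i j) ->
  (forall i j, Y n i j @[n --> \oo] --> F i j) ->
  fro (X n) (Y n) @[n --> \oo] --> fro E F.
Proof.
move=> XE YF; rewrite froE (_ : (fun n => _) =
    (fun n => \sum_j \sum_i X n i j * Y n i j)); last first.
  by apply/funext => n; rewrite froE.
by apply: cvg_sumr => j; apply: cvg_sumr => i; apply: cvgM.
Qed.

Definition fro_limit p q (S : 'M[R]_(p, q) -> Prop) (E : 'M[R]_(p, q)) :=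
  forall e, 0 < e -> exists2 X, S X & fro (X - E) (X - E) < e.

(** Almost minimizers [c k] of the norm over [C k] form a Cauchy sequence: for
    [k <= l] the midpoint of [c k] and [c l] lies in [C k], so by the parallelogram
    identity the distance of [c k] and [c l] is controlled by the increase of the
    infima from [k] to [l], and these are bounded.  A constant sequence [C] gives the
    projection of [0] onto the closure of a convex set. *)
Lemma nested_min_norm p q (C : nat -> 'M[R]_(p, q) -> Prop) (b : R) :
  (forall k X Y, C k X -> C k Y -> C k (2^-1 *: (X + Y))) ->
  (forall k X, C k.+1 X -> C k X) ->
  (forall k, exists2 X, C k X & fro X X <= b) ->
  exists E, (forall k, fro_limit (C k) E) /\
            (forall Y, (forall k, C k Y) -> fro E E <= fro Y Y).
Proof.
move=> Cmid Cdec Cb.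
have Cle k l X : (k <= l)%N -> C l X -> C k X.
  by move=> /subnK <-; elim: (l - k)%N => //= i IH /Cdec.
pose S k := [set fro X X | X in [set X | C k X]].
have S_lb k : has_lbound (S k).
  by exists 0 => _ [X _ <-]; exact: fro_ge0.
have S_inf k : has_inf (S k).
  by split=> //; have [X CX _] := Cb k; exists (fro X X), X.
pose d k := inf (S k).
have d_le k X : C k X -> d k <= fro X X.
  by move=> CX; apply: ge_inf => //; exists X.
have d_mono k l : (k <= l)%N -> d k <= d l.
  move=> kl; apply: lb_le_inf; first by case: (S_inf l).
  by move=> _ [X CX <-]; apply/d_le/(Cle _ l).
have d_b : has_ubound (range d).
  by exists b => _ [k _ <-]; have [X CX Xb] := Cb k; apply: le_trans (d_le _ _ CX) Xb.
have := nondecreasing_is_cvgn d_mono d_b.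
move=> d_cvg.
have /choice [c cP] : forall k, exists X, C k X /\ fro X X < d k + k.+1%:R^-1.
  move=> k; have k0 : 0 < k.+1%:R^-1 :> R by rewrite invr_gt0 ltr0n.
  by have [_ [X CX <-] Xd] := inf_adherent k0 (S_inf k); exists X.
have dist k l : (k <= l)%N ->
    fro (c k - c l) (c k - c l) <= 2 * (d l - d k) + 4 * k.+1%:R^-1.
  move=> kl; rewrite parallelogram.
  have [Ck ck] := cP k; have [Cl cl] := cP l.
  have := d_le _ _ (Cmid _ _ _ Ck (Cle _ _ _ kl Cl)).
  have : l.+1%:R^-1 <= k.+1%:R^-1 :> R by rewrite lef_pV2 ?posrE ?ltr0n // ler_nat.
  move: ck cl; set x := k.+1%:R^-1; set y := l.+1%:R^-1.
  by clearbody x y; lra.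
have c_cvg i j : cvgn (fun n => c n i j).
  apply/cauchy_cvgP/cauchy_exP => e e0.
  have e2 : 0 < e ^+ 2 / 8 by rewrite divr_gt0 // exprn_gt0.
  have [N1 _ hN1] := (@cvgr0Pnorm_lt _ _ _ _ _ _).1 (@cvg_harmonic R) _ e2.
  have /cvgrPdist_lt/(_ _ e2) [N2 _ hN2] := d_cvg.
  pose N := maxn N1 N2; exists (c N i j); exists N => // l /= Nl.
  have := hN1 N (leq_maxl _ _); have := hN2 N (leq_maxr _ _).
  have := nondecreasing_cvgn_le d_mono d_cvg l.
  rewrite /= [`|harmonic _|]ger0_norm ?harmonic_ge0 // /harmonic.
  move: (dist _ _ Nl) => h1 h2 /ltr_normlP[h3 h4] h5.
  rewrite /ball /= -(@ltr_pXn2r _ 2) ?nnegrE // ?ltW // real_normK ?num_real //.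
  have := sqr_entry_le_fro (c N - c l) i j; rewrite mxE [X in _ + X]mxE => h6.
  apply: le_lt_trans h6 _; apply: le_lt_trans h1 _.
  have {}h5 : N.+1%:R^-1 < e ^+ 2 / 8 by exact: h5.
  by move: e2 h2 h4 h5; move: (d N) (d l) (limn d : R) (e ^+ 2) (N.+1%:R^-1) => *; lra.
pose E := \matrix_(i, j) limn (fun n => c n i j).
have cE i j : c n i j @[n --> \oo] --> E i j by rewrite mxE; exact: c_cvg.
have cE2 : fro (c n - E) (c n - E) @[n --> \oo] --> 0.
  rewrite -[0](_ : fro (E - E) (E - E) = 0); last by rewrite subrr -(scale0r 0) froZr mul0r.
  have h i j : (c n - E) i j @[n --> \oo] --> (E - E) i j.
    rewrite (_ : (fun n => _) = (fun n => c n i j - E i j)).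
      have -> : (E - E) i j = E i j - E i j by rewrite mxE [X in _ + X]mxE.
      by apply: cvgB; [exact: cE|exact: cvg_cst].
    by apply/funext => n; rewrite mxE [X in _ + X]mxE.
  exact: cvgn_fro.
exists E; split=> [k e e0|Y CY].
  have /cvgr0Pnorm_lt/(_ e e0) := cE2.
  move=> [N _ NE]; exists (c (maxn k N)).
    by have [Cm _] := cP (maxn k N); apply: Cle Cm; rewrite leq_maxl.
  have := NE (maxn k N) (leq_maxr _ _); rewrite /= ger0_norm //.
  exact: fro_ge0.
have hl : d n + n.+1%:R^-1 @[n --> \oo] --> limn d + 0.
  by apply: cvgD => //; exact: cvg_harmonic.
apply: (@le_trans _ _ (limn d + 0)).
  apply: (ler_cvg_to (cvgn_fro cE cE) hl); apply: nearW => n.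
  by have [_ /ltW] := cP n.
by rewrite addr0; apply: limr_le => //; apply: nearW => n; apply/d_le/CY.
Qed.

Lemma fro_ge_limit p q (Y : 'M[R]_(p, q)) (b : R) :
  fro_limit (fun X => b <= fro X X) Y ->
  b <= fro Y Y.
Proof.
move=> H; rewrite leNgt; apply/negP => Yb.
set g := b - fro Y Y; have g0 : 0 < g by rewrite subr_gt0.
have y0 := fro_ge0 Y.
(* Expand [|Y + w|^2] with [2 <Y, w> <= s |Y|^2 + s^-1 |w|^2], where [s] is small
   enough for [s |Y|^2] to be at most half of the gap [g]. *)
pose s := g / (2 * (1 + fro Y Y)).
have s0 : 0 < s by rewrite divr_gt0 // mulr_gt0 //; lra.
have sY : s * fro Y Y <= g / 2.
  rewrite /s mulrAC ler_pdivrMr; last by rewrite mulr_gt0 //; lra.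
  have -> : g / 2 * (2 * (1 + fro Y Y)) = g * (1 + fro Y Y) by field.
  by rewrite ler_pM2l //; lra.
have s1 : 0 < 1 + s^-1 by rewrite addr_gt0 // invr_gt0.
have [|X bX XY] := H (g / 2 / (1 + s^-1)); first by rewrite !divr_gt0.
have [w XE] : exists w, X = Y + w by exists (X - Y); rewrite addrC subrK.
have XYE : X - Y = w by rewrite XE addrC addKr.
have cross : 2 * fro Y w <= s * fro Y Y + s^-1 * fro w w.
  have : 0 <= s^-1 * fro (s *: Y - w) (s *: Y - w).
    by rewrite mulr_ge0 ?fro_ge0 // invr_ge0 ltW.
  rewrite !(froDl, froDr, froNl, froNr, froZl, froZr) (froC w Y) -subr_ge0 => h.
  rewrite -subr_ge0; apply: le_trans h _; rewrite le_eqVlt; apply/orP; left.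
  by apply/eqP; field; rewrite gt_eqF.
move: bX XY; rewrite ltr_pdivlMr // XYE XE.
rewrite !(froDl, froDr) (froC w Y) => h1 h2.
by move: h1 h2 cross sY; rewrite /g; lra.
Qed.

(** The first order condition: moving from [E] towards [Y] cannot decrease the norm.
    As [E] is only a limit of points of [C], the move is first made from nearby
    points of [C]. *)
Lemma min_norm_variational p q (C : 'M[R]_(p, q) -> Prop) (E : 'M[R]_(p, q)) :
  (forall t X Y, 0 <= t <= 1 -> C X -> C Y -> C ((1 - t) *: X + t *: Y)) ->
  fro_limit C E ->
  (forall Y, C Y -> fro E E <= fro Y Y) ->
  forall Y, C Y -> fro E E <= fro E Y.
Proof.
move=> Ccv CE Emin Y CY; rewrite leNgt; apply/negP => EY.
set g := fro E E - fro E Y; have g0 : 0 < g by rewrite subr_gt0.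
have [W WE] : exists W, W = Y - E by exists (Y - E).
have w0 := fro_ge0 W.
(* A step length for which the second order term does not outweigh the first. *)
pose t := g / (g + fro W W).
have gW : 0 < g + fro W W by rewrite ltr_pwDl.
have t0 : 0 < t by rewrite divr_gt0.
have t1 : t <= 1 by rewrite ler_pdivrMr // mul1r lerDl.
have : fro E E <= fro (E + t *: W) (E + t *: W).
  apply: fro_ge_limit => e e0; have [X CX XE] := CE e e0.
  exists ((1 - t) *: X + t *: Y).
    by apply: Emin; apply: Ccv => //; rewrite ltW.
  have -> : (1 - t) *: X + t *: Y - (E + t *: W) = (1 - t) *: (X - E).
    apply/matrixP => i j; rewrite WE !mxE; ring.
  apply: le_lt_trans XE; rewrite froZl froZr mulrA -expr2 ler_piMl ?fro_ge0 //.
  by rewrite expr_le1 ?subr_ge0 // gerBl ltW.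
rewrite !(froDl, froDr, froZl, froZr) (froC W E).
have -> : fro E W = - g by rewrite WE froDr froNr /g opprB.
have tW : t * fro W W < g.
  by rewrite /t mulrAC ltr_pdivrMr // ltr_pM2l // ltrDr.
move=> h; have : 0 <= t * (t * fro W W - 2 * g) by lra.
by rewrite pmulr_rge0 //; lra.
Qed.

Lemma sym_limit n (S : 'M[R]_n -> Prop) E :
  (forall X, S X -> X^T = X) -> fro_limit S E -> E^T = E.
Proof.
move=> Ssym SE; apply/eqP; rewrite -subr_eq0; apply/eqP/fro_eq0.
apply/eqP; rewrite eq_le fro_ge0 andbT leNgt; apply/negP => e0.
have [|c Sc cd] := SE (fro (E^T - E) (E^T - E) / 4); first by rewrite divr_gt0.
have ET : E^T - E = (c - E) - (c - E)^T.
  by rewrite linearB /= (Ssym _ Sc) opprB [RHS]addrC addrA subrK.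
move: cd e0; rewrite ET (parallelogram (c - E)) fro_tr.
have := fro_ge0 (2^-1 *: ((c - E) + (c - E)^T)).
by move: (fro _ _) (fro _ _) => x y; lra.
Qed.

Lemma halfspace_limit p q (S : 'M[R]_(p, q) -> Prop) (G E : 'M[R]_(p, q)) b :
  (forall X, S X -> 0 <= fro G X + b) -> fro_limit S E -> 0 <= fro G E + b.
Proof.
move=> h SE; rewrite leNgt; apply/negP => h0.
set g := fro G E + b in h0.
have gg : 0 < g ^+ 2 by rewrite exprn_even_gt0 //= lt_eqF.
have G1 : 0 < 1 + fro G G by rewrite ltr_pwDl // fro_ge0.
have [|X SX XE] := SE (g ^+ 2 / (1 + fro G G)); first by rewrite divr_gt0.
have := fro_CS G (X - E); have := h _ SX.
have -> : fro G X = fro G (X - E) + fro G E by rewrite froDr froNr subrK.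
rewrite -addrA -/g; move: XE; rewrite ltr_pdivlMr //.
set x := fro G (X - E); set y := fro (X - E) (X - E) => h1 h2 h3.
have : g ^+ 2 <= x ^+ 2.
  by rewrite -sqrrN ler_pXn2r // ?nnegrE; lra.
have y0 : 0 <= y := fro_ge0 _.
by move: h1 h3; rewrite mulrDr mulr1 [y * _]mulrC; lra.
Qed.

Lemma congruence_limit p q (S : 'M[R]_p -> Prop) (E : 'M[R]_p) (Z : 'M[R]_(p, q)) :
  fro_limit S E ->
  fro_limit (fun X => exists2 Y, S Y & X = Z^T *m Y *m Z) (Z^T *m E *m Z).
Proof.
move=> SE e e0; have Z1 : 0 < 1 + fro Z Z * fro Z Z.
  by rewrite ltr_pwDl // mulr_ge0 ?fro_ge0.
have [|Y SY YE] := SE (e / (1 + fro Z Z * fro Z Z)); first by rewrite divr_gt0.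
exists (Z^T *m Y *m Z); first by exists Y.
rewrite -mulmxBl -mulmxBr; apply: le_lt_trans (fro_mulmx _ _) _.
apply: le_lt_trans (_ : fro Z Z * fro (Y - E) (Y - E) * fro Z Z < _).
  by rewrite ler_wpM2r ?fro_ge0 // -[fro Z Z in leRHS]fro_tr fro_mulmx.
move: YE; rewrite ltr_pdivlMr //; have := fro_ge0 (Y - E).
by set y := fro (Y - E) _; rewrite mulrDr mulr1 mulrAC [_ * y]mulrC; lra.
Qed.

(** Polarization: the entries of a symmetric [X] are combinations of values of its form. *)
Lemma fro_bounded_of_forms n (S : 'M[R]_n -> Prop) :
  (forall X, S X -> X^T = X) ->
  (forall v : 'cV_n, exists c, forall X, S X -> `|(v^T *m X *m v) 0 0| <= c) ->
  exists b, forall X, S X -> fro X X <= b.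
Proof.
move=> Ssym /choice [c cP].
pose d (i : 'I_n) : 'cV[R]_n := delta_mx i 0.
pose m i j := c (d i + d j) + c (d i) + c (d j).
exists (\sum_j \sum_i m i j ^+ 2) => X SX; rewrite froE.
apply: ler_sum => j _; apply: ler_sum => i _; rewrite -expr2.
have form k l : ((d k)^T *m X *m d l) 0 0 = X k l.
  by rewrite trmx_delta -rowE -colE !mxE.
have := cP (d i + d j) _ SX; have := cP (d i) _ SX; have := cP (d j) _ SX.
have -> : ((d i + d j)^T *m X *m (d i + d j)) 0 0 = X i i + X j j + 2 * X i j.
  rewrite [(d i + d j)^T]linearD /= !mulmxDr !mulmxDl mxE [X in X + _]mxE [X in _ + X]mxE.
  have Xji : X j i = X i j by rewrite -{1}(Ssym _ SX) mxE.
  by rewrite !form Xji; ring.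
rewrite !form => hj hi hij; rewrite -real_normK ?num_real //.
have m0 : `|X i j| <= m i j; last first.
  by rewrite ler_pXn2r // ?nnegrE // (le_trans _ m0).
have e : 2 * X i j = (X i i + X j j + 2 * X i j) - X i i - X j j by ring.
have := ler_normB (X i i + X j j + 2 * X i j - X i i) (X j j).
have := ler_normB (X i i + X j j + 2 * X i j) (X i i).
rewrite -e normrM ger0_norm // /m; have := normr_ge0 (X i j).
by lra.
Qed.

Lemma ge0_of_affine_bound (a b q : R) : (forall t, 0 <= t -> a <= t * q + b) -> 0 <= q.
Proof.
move=> h; rewrite leNgt; apply/negP => q0.
have := h ((1 + `|a - b|) / (- q)) ; rewrite divr_ge0; last 2 first.
- by rewrite addr_ge0.
- by rewrite oppr_ge0 ltW.
move=> /(_ isT); rewrite invrN mulrN mulNr divfK ?lt_eqF // => h1.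
by have := ler_norm (b - a); rewrite distrC; lra.
Qed.

End Projection.

(** * From the frequency domain inequality to approximate storage matrices *)

Section FrequencyDomain.
Variable R : realType.
Local Notation cmx := (map_mx (real_complex R)).
Local Notation remx := (map_mx (@complex.Re R)).
Local Notation immx := (map_mx (@complex.Im R)).
Local Open Scope sesquilinear_scope.

Lemma unitary_diag (C : numClosedFieldType) k (L U : 'M[C]_k) d : U \is unitarymx ->
  L = invmx U *m diag_mx d *m U -> L *m U^t* = U^t* *m diag_mx d.
Proof.
by move=> uU ->; rewrite invmx_unitary // -(mulmxA _ U) (unitarymxP uU) mulmx1.
Qed.

(** [L] is diagonalizable in an orthonormal basis with imaginary eigenvalues, and the
    trace of [N] is the sum over that basis of the values of its form. *)
Lemma trace_skew_ge0 (k : nat) (L N : 'M[R]_k) : L^T = - L ->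
  (forall (om : R) (a b : 'cV_k), L *m a = - om *: b -> L *m b = om *: a ->
     0 <= (a^T *m N *m a) 0 0 + (b^T *m N *m b) 0 0) ->
  0 <= \tr N.
Proof.
move=> Lskew H.
have skew0 (x : 'cV[R]_k) : (x^T *m L *m x) 0 0 = 0.
  apply/eqP; rewrite -eqNr; apply/eqP; rewrite [RHS]form_tr Lskew mulmxN mulNmx.
  by rewrite [RHS]mxE.
have cLadj : (cmx L)^t* = - cmx L.
  by rewrite adj_real Lskew map_mxN.
have nL : cmx L \is normalmx.
  by apply/normalmxP; rewrite cLadj mulmxN mulNmx.
have /orthomx_spectralP := nL.
set U := spectralmx (cmx L); set d := spectral_diag (cmx L) => LE.
have uU : U \is unitarymx := spectral_unitarymx _.
have UU : U^t* *m U = 1%:M by apply: mulmx1C; apply/unitarymxP.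
have LU : cmx L *m U^t* = U^t* *m diag_mx d.
  exact: unitary_diag uU LE.
pose w j : 'cV[R[i]]_k := col j (U^t*).
have wL j : cmx L *m w j = d 0 j *: w j.
  rewrite /w -col_mulmx LU; apply/matrixP => i i'; rewrite mul_mx_diag !mxE.
  by rewrite mulrC.
have trE : (\tr N)%:C%C = \sum_j (map_mx Num.conj (w j)^T *m cmx N *m w j) 0 0.
  transitivity (\tr (U *m cmx N *m U^t*)).
    rewrite mxtrace_mulC mulmxA UU mul1mx /mxtrace rmorph_sum.
    by apply: eq_bigr => i _; rewrite mxE.
  apply: eq_bigr => j _; rewrite -!mulmxA !mxE; apply: eq_bigr => i _.
  by rewrite /w -col_mulmx !mxE conjCK.
have : 0 <= complex.Re (\tr N)%:C%C; last by [].
rewrite trE Re_sum sumr_ge0 // => j _; rewrite Re_hermitian_form.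
have := congr1 (fun M => remx M) (wL j); have := congr1 (fun M => immx M) (wL j).
rewrite /= remx_scale immx_scale remx_mul immx_mul remx_real immx_real.
rewrite !mul0mx addr0 subr0.
set a := remx (w j); set b := immx (w j).
set al := complex.Re _; set om := complex.Im _ => Lb La.
(* The eigenvalue is imaginary, since [x^T *m L *m x = 0] for every real [x]. *)
have [al0|al0] := eqVneq al 0.
  by apply: (H om); rewrite ?La ?Lb al0 scale0r ?addr0 // add0r scaleNr.
have : al * ((a^T *m a) 0 0 + (b^T *m b) 0 0) = 0.
  have := congr1 (fun x => (a^T *m x) 0 0) La; have := congr1 (fun x => (b^T *m x) 0 0) Lb.
  rewrite /= !mulmxA !skew0 mulmxDr mulmxBr -!scalemxAr.
  rewrite mxE ![X in _ = X + _]mxE [X in _ = _ + X]mxE => h1.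
  rewrite mxE [X in _ = X + _]mxE [X in _ = _ + X]mxE [X in _ = _ - X]mxE => h2.
  have ab : (a^T *m b) 0 0 = (b^T *m a) 0 0.
    by have := form_tr 1%:M a b; rewrite trmx1 !mulmx1.
  by rewrite mulrDr; move: h1 h2; rewrite ab; lra.
move=> /eqP; rewrite mulf_eq0 (negPf al0) /= paddr_eq0 ?sqn_ge0 //.
by move=> /andP[/eqP/sqn_eq0 -> /eqP/sqn_eq0 ->]; rewrite !mulmx0 mxE addr0.
Qed.

(** The matrix [E] with blocks [E11], [E12], [E22] is the covariance of a stationary
    state and input.  As [E] is positive semidefinite, its lower left block is
    [H0 *m E11]: the input is a state feedback [H0] plus an independent part of
    covariance [Xi].  The closed loop matrix [K] acts on the factor [G] of [E11] as a
    skew matrix [L], whose eigenvectors are the harmonic solutions for which the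
    frequency inequality is assumed; the part [Xi] sees only [D]. *)
Lemma positive_real_trace_ge0 (r m : nat) (A : 'M[R]_r) (B : 'M[R]_(r, m)) (C : 'M[R]_(m, r))
    (D : 'M[R]_m) (E11 : 'M[R]_r) (E12 : 'M[R]_(r, m)) (E22 : 'M[R]_m) :
  (forall (om : R) (a b : 'cV_r) (c d : 'cV_m),
     A *m a + B *m c = - om *: b -> A *m b + B *m d = om *: a ->
     0 <= (c^T *m (C *m a + D *m c)) 0 0 + (d^T *m (C *m b + D *m d)) 0 0) ->
  (forall u : 'cV_m, 0 <= (u^T *m D *m u) 0 0) ->
  psdmx (block_mx E11 E12 E12^T E22) ->
  (A *m E11 + B *m E12^T)^T = - (A *m E11 + B *m E12^T) ->
  0 <= \tr (C *m E12 + D *m E22).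
Proof.
move=> H D0 psdE skewT.
have [Es E_ge0] := psdE; move: (Es).
rewrite tr_block_mx => /eq_block_mx [E11s _ _ E22s].
have psd11 : psdmx E11.
  split=> // v; have := E_ge0 (col_mx v 0).
  rewrite -mulmxA mul_block_col !mulmx0 !addr0 tr_col_mx mul_row_col trmx0 mul0mx.
  by rewrite addr0 mulmxA.
(* The kernel of [E11] is contained in the kernel of [E12^T]. *)
have [H0 H0E] : exists H0, E12^T = H0 *m E11.
  apply/submxP; rewrite submxE; apply/eqP/matrixP => i j.
  pose v := col j (cokermx E11).
  have v0 : E11 *m v = 0 by rewrite /v -col_mulmx mulmx_coker col0.
  have : block_mx E11 E12 E12^T E22 *m col_mx v 0 = 0.
    apply: (psd_kernel psdE).
    rewrite -mulmxA mul_block_col !mulmx0 !addr0 v0 tr_col_mx mul_row_col trmx0 mul0mx.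
    by rewrite mulmx0 addr0 mxE.
  rewrite mul_block_col !mulmx0 !addr0 -[0 in RHS]vsubmxK => /eq_col_mx[_].
  rewrite linear0 /v -col_mulmx => /matrixP/(_ i 0).
  by rewrite !mxE.
have E12E : E12 = E11 *m H0^T by apply: trmx_inj; rewrite trmx_mul trmxK E11s.
pose Xi := E22 - H0 *m E11 *m H0^T.
(* [Xi] is the Schur complement of [E11]. *)
have psdXi : psdmx Xi.
  split.
    by rewrite /Xi linearB /= E22s !trmx_mul trmxK E11s mulmxA.
  move=> u; have := E_ge0 (col_mx (- (H0^T *m u)) u).
  rewrite -mulmxA mul_block_col H0E E12E !mulmxN !mulmxA addNr tr_col_mx mul_row_col.
  by rewrite mulmx0 add0r [- _ + _]addrC -mulmxBl mulmxA.
have [k [G [GE Ginj]]] := psd_factor psd11.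
have [Z ZG] := inj_left_inverse Ginj.
pose K := A + B *m H0.
have TE : A *m E11 + B *m E12^T = K *m G *m G^T.
  by rewrite H0E /K -mulmxA -GE mulmxDl mulmxA.
have GZ : G^T *m Z^T = 1%:M by rewrite -trmx_mul ZG trmx1.
move: skewT; rewrite TE !trmx_mul trmxK => skewT.
pose L := - (G^T *m K^T *m Z^T).
have KG : K *m G = G *m L.
  rewrite -[LHS]mulmx1 -GZ mulmxA -[K *m G *m _]opprK -skewT /L.
  by rewrite !mulNmx mulmxN !mulmxA.
have Lskew : L^T = - L.
  by rewrite {1}/L linearN /= !trmx_mul !trmxK KG mulmxA ZG mul1mx //.
have DE : \tr (C *m E12 + D *m E22) =
    \tr (G^T *m (H0^T *m (C + D *m H0)) *m G) + \tr (D *m Xi).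
  rewrite -[in RHS]mulmxA mxtrace_mulC.
  have -> : E22 = Xi + H0 *m E11 *m H0^T by rewrite subrK.
  rewrite mulmxDr !linearD /= addrCA addrC; congr (_ + _).
  rewrite -!mulmxA -GE mxtrace_mulC -mxtraceD E12E.
  by rewrite -mulmxDr (mulmxA E11) [RHS]mxtrace_mulC mulmxDl !mulmxA.
rewrite DE addr_ge0 //; last by rewrite trace_psd_ge0.
apply: (trace_skew_ge0 Lskew) => om a b La Lb.
have := H om (G *m a) (G *m b) (H0 *m (G *m a)) (H0 *m (G *m b)).
rewrite !(mulmxA B) -!mulmxDl -/K !(mulmxA K) KG -!(mulmxA G) La Lb -!scalemxAr.
move=> /(_ erefl erefl).
by rewrite !trmx_mul !(mulmxA D) -!mulmxDl !mulmxA.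
Qed.

End FrequencyDomain.

Section KYP.
Variable R : realType.

Definition kyp (r m : nat) (A : 'M[R]_r) (B : 'M[R]_(r, m)) (C : 'M[R]_(m, r))
    (D : 'M[R]_m) (X : 'M[R]_r) : 'M[R]_(r + m) :=
  block_mx (- (A^T *m X) - X *m A) (C^T - X *m B) (C - B^T *m X) (D + D^T).

Lemma sym_submxK p q (E : 'M[R]_(p + q)) : E^T = E ->
  E = block_mx (ulsubmx E) (ursubmx E) (ursubmx E)^T (drsubmx E).
Proof. by move=> Es; rewrite trmx_ursub Es submxK. Qed.

Variables (r m : nat) (A : 'M[R]_r) (B : 'M[R]_(r, m)) (C : 'M[R]_(m, r)).
Variable D : 'M[R]_m.
Local Notation K := (kyp A B C D).

Lemma kyp_comb s t (X Y : 'M[R]_r) : s + t = 1 ->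
  K (s *: X + t *: Y) = s *: K X + t *: K Y.
Proof.
move=> st; rewrite /kyp !scale_block_mx add_block_mx.
rewrite !mulmxDr !mulmxDl -!scalemxAr -!scalemxAl.
have -> : t = 1 - s by rewrite -st addrAC subrr add0r.
by congr block_mx; apply/matrixP => i j; rewrite !mxE; ring.
Qed.

Lemma kyp_sym X : X^T = X -> (K X)^T = K X.
Proof.
move=> Xs; rewrite /kyp tr_block_mx; congr block_mx.
- by rewrite linearB linearN /= !trmx_mul trmxK Xs addrC.
- by rewrite linearB /= trmx_mul trmxK Xs.
- by rewrite linearB /= trmx_mul trmxK Xs.
- by rewrite linearD /= trmxK addrC.
Qed.

(** The adjoint of the affine map [kyp], on symmetric matrices. *)
Lemma kyp_dual (E : 'M[R]_(r + m)) (X : 'M[R]_r) : E^T = E -> X^T = X ->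
  let E11 := ulsubmx E in let E12 := ursubmx E in let E22 := drsubmx E in
  fro E (K X) = 2 * \tr (C *m E12 + D *m E22)
                - 2 * \tr (X *m (A *m E11 + B *m E12^T)).
Proof.
move=> Es Xs E11 E12 E22.
have EE : E = block_mx E11 E12 E12^T E22 := sym_submxK Es.
have E11s : E11^T = E11.
  by rewrite /E11 trmx_ulsub Es.
have E22s : E22^T = E22.
  by rewrite /E22 trmx_drsub Es.
rewrite /fro Es {1}EE /kyp mulmx_block mxtrace_block.
have trN p (M : 'M[R]_p) : \tr (- M) = - \tr M by rewrite linearN.
rewrite !(mulmxDr, mulmxN, mxtraceD, trN).
have -> : \tr (E11 *m (A^T *m X)) = \tr (X *m (A *m E11)).
  by rewrite -mxtrace_tr !trmx_mul trmxK E11s Xs -mulmxA.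
have -> : \tr (E11 *m (X *m A)) = \tr (X *m (A *m E11)).
  by rewrite mxtrace_mulC mulmxA.
have -> : \tr (E12 *m (B^T *m X)) = \tr (X *m (B *m E12^T)).
  by rewrite -mxtrace_tr !trmx_mul trmxK Xs -mulmxA.
have -> : \tr (E12^T *m (X *m B)) = \tr (X *m (B *m E12^T)).
  by rewrite mxtrace_mulC mulmxA.
have -> : \tr (E12^T *m C^T) = \tr (C *m E12).
  by rewrite -mxtrace_tr trmx_mul !trmxK.
have -> : \tr (E22 *m D^T) = \tr (D *m E22).
  by rewrite -mxtrace_tr trmx_mul trmxK E22s.
rewrite (mxtrace_mulC E12 C) (mxtrace_mulC E22 D).
ring.
Qed.

(** [E] is the element of least norm of the closure of [S]; its first order condition
    reads [|E|^2 <= <E, Z> - <E, K X>].  Letting [Z] grow along [v *m v^T] gives the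
    positivity of [E], and letting [X] grow in both directions gives a Lyapunov
    equation for its blocks.  With [X = Z = 0] the frequency inequality makes the
    right hand side nonpositive, so [E = 0] is a limit of points of [S]. *)
Lemma kyp_approx :
  (forall (om : R) (a b : 'cV_r) (c d : 'cV_m),
     A *m a + B *m c = - om *: b -> A *m b + B *m d = om *: a ->
     0 <= (c^T *m (C *m a + D *m c)) 0 0 + (d^T *m (C *m b + D *m d)) 0 0) ->
  (forall u : 'cV_m, 0 <= (u^T *m D *m u) 0 0) ->
  forall eta, 0 < eta -> exists2 X, X^T = X & psdmx (K X + eta%:M).
Proof.
move=> H D0.
pose S := fun c => exists X Z, [/\ X^T = X, psdmx Z & c = Z - K X].
have S_cv t X Y : 0 <= t <= 1 -> S X -> S Y -> S ((1 - t) *: X + t *: Y).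
  move=> /andP[t0 t1] [X1 [Z1 [X1s Z1p ->]]] [X2 [Z2 [X2s Z2p ->]]].
  exists ((1 - t) *: X1 + t *: X2), ((1 - t) *: Z1 + t *: Z2); split.
  - by rewrite linearD !linearZ /= X1s X2s.
  - by apply: psd_add; apply: psd_scale => //; rewrite subr_ge0.
  - rewrite kyp_comb ?subrK // !scalerBr.
    by rewrite addrACA -opprD.
have S0 : S (0 - K 0) by exists 0, 0; split; [rewrite trmx0|exact: psd_zero|].
have [|||E [SE Emin]] := @nested_min_norm R _ _ (fun=> S) (fro (0 - K 0) (0 - K 0)).
- move=> _ X Y SX SY; have := S_cv 2^-1 _ _ _ SX SY.
  have -> : 1 - 2^-1 = 2^-1 :> R by field.
  by rewrite scalerDr; apply; apply/andP; split; lra.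
- by [].
- by move=> _; exists (0 - K 0).
have {Emin}Emin Y : S Y -> fro E E <= fro Y Y by move=> SY; exact: Emin.
have Evar := min_norm_variational S_cv (SE 0%N) Emin.
have Es : E^T = E.
  by apply: sym_limit (SE 0%N) => _ [X [Z [Xs [Zs _] ->]]]; rewrite linearB /= Zs kyp_sym.
have E_psd : psdmx E.
  split=> // v; apply: (ge0_of_affine_bound (a := fro E E) (b := - fro E (K 0))) => t t0.
  have := Evar (t *: (v *m v^T) - K 0); rewrite froDr froNr froZr fro_outer.
  apply; exists 0, (t *: (v *m v^T)); split; rewrite ?trmx0 //.
  exact: psd_scale (psd_outer _).
pose E11 := ulsubmx E; pose E12 := ursubmx E; pose E22 := drsubmx E.
have EE : E = block_mx E11 E12 E12^T E22 := sym_submxK Es.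
pose T := A *m E11 + B *m E12^T.
have Tskew : T^T = - T.
  pose X := T + T^T; have Xs : X^T = X by rewrite /X linearD /= trmxK addrC.
  have tXs t : (t *: X)^T = t *: X by rewrite linearZ /= Xs.
  have h t : fro E E <= t * (2 * \tr (X *m T)) - 2 * \tr (C *m E12 + D *m E22).
    have := Evar (0 - K (t *: X)); rewrite sub0r froNr kyp_dual //.
    rewrite -/E11 -/E12 -/E22 -/T -scalemxAl mxtraceZ opprB mulrCA; apply.
    by exists (t *: X), 0; split=> //; [exact: psd_zero|rewrite sub0r].
  have X0 : fro X X = 2 * \tr (X *m T).
    rewrite /fro Xs {2}/X mulmxDr mxtraceD mulr_natl mulr2n; congr (_ + _).
    by rewrite -[LHS]mxtrace_tr trmx_mul trmxK Xs mxtrace_mulC.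
  suff : X = 0 by move/eqP; rewrite /X addrC addr_eq0 => /eqP.
  apply: fro_eq0; apply/eqP; rewrite eq_le fro_ge0 andbT -oppr_ge0.
  apply: ge0_of_affine_bound => t _; have := h (- t).
  by rewrite -X0 mulNr mulrN; exact.
have E0 : E = 0.
  apply: fro_eq0; apply/eqP; rewrite eq_le fro_ge0 andbT.
  have := Evar _ S0; rewrite sub0r froNr kyp_dual ?trmx0 // mul0mx mxtrace0 mulr0 subr0.
  move=> h; apply: le_trans h _; rewrite oppr_le0 mulr_ge0 //.
  by apply: (positive_real_trace_ge0 H D0 _ Tskew); rewrite -EE.
move=> eta eta0.
have [|c [X [Z [Xs [Zs Z0] cE]]] cd] := SE 0%N (eta ^+ 2); first by rewrite exprn_gt0.
exists X => //; split=> [|v].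
  by rewrite linearD /= kyp_sym // tr_scalar_mx.
have -> : K X + eta%:M = Z - c + eta%:M by rewrite cE opprB addrCA subrr addr0.
rewrite !mulmxDr mulmxN mul_mx_scalar !mulmxDl mulNmx -scalemxAl mxE [X in X + _]mxE.
rewrite [X in _ + X + _]mxE [X in _ + X]mxE.
have := Z0 v; have := form_le_fro (M := c) v (ltW eta0).
rewrite E0 subr0 in cd => /(_ (ltW cd)).
lra.
Qed.

(** The feasible set is an intersection of half-spaces. *)
Lemma kyp_limit (eta : R) (S : 'M[R]_r -> Prop) (E : 'M[R]_r) :
  (forall X, S X -> X^T = X /\ psdmx (K X + eta%:M)) -> fro_limit S E ->
  E^T = E /\ psdmx (K E + eta%:M).
Proof.
move=> SK SE; have Es : E^T = E by apply: sym_limit SE => X /SK[].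
split=> //; split=> [|v].
  by rewrite linearD /= kyp_sym // tr_scalar_mx.
have [vs _] := psd_outer v; pose U := v *m v^T.
pose T := A *m ulsubmx U + B *m (ursubmx U)^T.
pose b := 2 * \tr (C *m ursubmx U + D *m drsubmx U) + fro U eta%:M.
have e X : X^T = X -> (v^T *m (K X + eta%:M) *m v) 0 0 = fro (- 2 *: T) X + b.
  move=> Xs; rewrite -fro_outer froC froDr kyp_dual // -/U -/T /b.
  rewrite -{1}Xs -/(fro X T) froZl (froC T X); ring.
rewrite e //; apply: halfspace_limit SE => X /SK[Xs [_ XK]].
by rewrite -e.
Qed.

(** A limit for the values [eta = k.+1%:R^-1], along elements of almost least norm, which
    converge because their norms are bounded; it lies in all the closed sets that
    these values define. *)
Lemma kyp_solvable :
  (forall eta, 0 < eta -> exists2 X, X^T = X & psdmx (K X + eta%:M)) ->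
  (exists b, forall X, X^T = X /\ psdmx (K X + 1%:M) -> fro X X <= b) ->
  exists2 X, X^T = X & psdmx (K X).
Proof.
move=> approx [b bP].
pose S (k : nat) X := X^T = X /\ psdmx (K X + (k.+1%:R^-1)%:M).
have psd_scalar (t : R) n : 0 <= t -> psdmx (t%:M : 'M[R]_n).
  move=> t0; split=> [|v]; first by rewrite tr_scalar_mx.
  by rewrite mul_mx_scalar -scalemxAl mxE mulr_ge0 ?sqn_ge0.
have Sle (k : nat) X (t : R) : t <= k.+1%:R^-1 -> psdmx (K X + t%:M) ->
    psdmx (K X + (k.+1%:R^-1)%:M).
  move=> tk XK.
  have -> : K X + (k.+1%:R^-1)%:M = K X + t%:M + (k.+1%:R^-1 - t)%:M.
    by rewrite -addrA -raddfD /= (addrC t) subrK.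
  by apply: psd_add => //; apply: psd_scalar; rewrite subr_ge0.
have [|||E [SE _]] := @nested_min_norm R _ _ S b.
- move=> k X Y [Xs XK] [Ys YK]; split.
    by rewrite linearZ linearD /= Xs Ys.
  rewrite scalerDr kyp_comb; last by field.
  move: XK YK; move: (K X) (K Y) (_%:M) => MX MY t XK YK.
  have -> : 2^-1 *: MX + 2^-1 *: MY + t = 2^-1 *: (MX + t) + 2^-1 *: (MY + t).
    by apply/matrixP => i j; rewrite !mxE; field.
  by apply: psd_add; apply: psd_scale => //; rewrite invr_ge0.
- move=> k X [Xs XK]; split=> //; apply: Sle XK.
  by rewrite lef_pV2 ?posrE ?ltr0n // ler_nat.
- move=> k; have [|X Xs XK] := approx k.+1%:R^-1; first by rewrite invr_gt0 ltr0n.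
  exists X => //; apply: bP; split=> //.
  have -> : 1 = (1%:R^-1 : R) by rewrite invr1.
  apply: Sle XK; rewrite lef_pV2 ?posrE ?ltr0n // ler_nat //.
have Ek k : E^T = E /\ psdmx (K E + (k.+1%:R^-1)%:M).
  by apply: (@kyp_limit _ (S k)) => // e e0; exact: SE.
have [Es _] := Ek 0%N; exists E => //; split=> [|v]; first exact: kyp_sym.
rewrite leNgt; apply/negP => v0.
set q := (v^T *m K E *m v) 0 0 in v0.
pose x := (v^T *m v) 0 0; have x0 : 0 <= x := sqn_ge0 v.
have h k : 0 <= q + k.+1%:R^-1 * x.
  have [_ [_ /(_ v)]] := Ek k.
  by rewrite mulmxDr mulmxDl mul_mx_scalar -scalemxAl mxE [X in _ + X]mxE.
have [k kP] : exists k : nat, x / (- q) < k.+1%:R.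
  by exists (Num.truncn (x / - q)); exact: truncnS_gt.
have : x / k.+1%:R < - q.
  by rewrite ltr_pdivrMr ?ltr0n // mulrC -ltr_pdivrMr ?oppr_gt0.
by have := h k; rewrite mulrC; move: (x / _) => y; lra.
Qed.

End KYP.

(** * Trajectories *)

Section Calculus.
Variable R : realType.
Local Open Scope classical_set_scope.

Lemma is_derive_sumr (n : nat) (h : 'I_n -> R -> R) (t : R) (dh : 'I_n -> R) :
  (forall i, is_derive t (1 : R) (h i) (dh i)) ->
  is_derive t (1 : R) (fun s => \sum_i h i s) (\sum_i dh i).
Proof.
move=> hd; rewrite (_ : (fun s => _) = \sum_i h i).
  exact: is_derive_sum.
by apply/funext => s; rewrite fct_sumE.
Qed.

Lemma is_derive_prod (f g : R -> R) (t df dg : R) :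
  is_derive t (1 : R) f df -> is_derive t (1 : R) g dg ->
  is_derive t (1 : R) (fun s => f s * g s) (df * g t + f t * dg).
Proof.
move=> fd gd; apply: is_derive_eq (is_deriveM fd gd) _.
by rewrite addrC mulrC.
Qed.

Lemma is_derive_mulmx (p q : nat) (N : 'M[R]_(p, q)) (x : R -> 'cV[R]_q) (t : R)
    (dx : 'cV[R]_q) i :
  (forall j, is_derive t (1 : R) (fun s => x s j 0) (dx j 0)) ->
  is_derive t (1 : R) (fun s => (N *m x s) i 0) ((N *m dx) i 0).
Proof.
move=> xd; rewrite mxE (_ : (fun s => _) = (fun s => \sum_j N i j * x s j 0)).
  exact: is_derive_sumr.
by apply/funext => s; rewrite mxE.
Qed.

Lemma is_derive_dot (n : nat) (x y : R -> 'cV[R]_n) (t : R) (dx dy : 'cV[R]_n) :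
  (forall j, is_derive t (1 : R) (fun s => x s j 0) (dx j 0)) ->
  (forall j, is_derive t (1 : R) (fun s => y s j 0) (dy j 0)) ->
  is_derive t (1 : R) (fun s => ((x s)^T *m y s) 0 0)
    ((dx^T *m y t) 0 0 + ((x t)^T *m dy) 0 0).
Proof.
move=> xd yd; rewrite (_ : (fun s => _) = (fun s => \sum_j x s j 0 * y s j 0)).
  rewrite 2!mxE -big_split /= (eq_bigr (fun j => dx j 0 * y t j 0 + x t j 0 * dy j 0)).
    have xyd j := is_derive_prod (xd j) (yd j).
    exact: is_derive_sumr.
  by move=> j _; rewrite 2!mxE.
by apply/funext => s; rewrite mxE; apply: eq_bigr => j _; rewrite mxE.
Qed.

Lemma continuous_mulmx (p q : nat) (N : 'M[R]_(p, q)) (x : R -> 'cV[R]_q) i :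
  (forall j, continuous (fun s => x s j 0)) -> continuous (fun s => (N *m x s) i 0).
Proof.
move=> xc; rewrite (_ : (fun s => _) = (fun s => \sum_j N i j * x s j 0)).
  by move=> t; apply: cvg_sumr => j; apply: cvgM; [exact: cvg_cst|exact: xc].
by apply/funext => s; rewrite mxE.
Qed.

Lemma continuous_dot (n : nat) (x y : R -> 'cV[R]_n) :
  (forall j, continuous (fun s => x s j 0)) ->
  (forall j, continuous (fun s => y s j 0)) ->
  continuous (fun s => ((x s)^T *m y s) 0 0).
Proof.
move=> xc yc; rewrite (_ : (fun s => _) = (fun s => \sum_j x s j 0 * y s j 0)).
  by move=> t; apply: cvg_sumr => j; apply: cvgM; [exact: xc|exact: yc].
by apply/funext => s; rewrite mxE; apply: eq_bigr => j _; rewrite mxE.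
Qed.

Variables (k m : nat) (A : 'M[R]_k) (B : 'M[R]_(k, m)).

Lemma trajectory_continuous (u : R -> 'cV[R]_m) x j :
  trajectory A B u x -> continuous (fun t => x t j 0).
Proof.
move=> [_ xd] t; have [/derivable1_diffP/differentiable_continuous] := xd t j.
by [].
Qed.

Lemma supply_continuous (u : R -> 'cV[R]_m) x (C : 'M[R]_(m, k)) (D : 'M[R]_m) :
  trajectory A B u x -> continuous (fun t => ((C *m x t + D *m u t)^T *m u t) 0 0).
Proof.
move=> tr; apply: continuous_dot => j; last by have [uc _] := tr; exact: uc.
rewrite (_ : (fun s => _) = (fun s => (C *m x s) j 0 + (D *m u s) j 0)).
  move=> t; apply: cvgD; apply: continuous_mulmx => i.
    exact: trajectory_continuous tr.
  by have [uc _] := tr; exact: uc.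
by apply/funext => s; rewrite mxE.
Qed.

(** The real part of [e^{(sg + i om) t} (a + i b)]; its imaginary part is
    [rotexp sg om b (- a)]. *)
Definition rotexp p (sg om : R) (a b : 'cV[R]_p) (t : R) : 'cV[R]_p :=
  expR (sg * t) *: (cos (om * t) *: a - sin (om * t) *: b).

Lemma rotexp_derive p sg om (a b : 'cV[R]_p) t i :
  is_derive t (1 : R) (fun s => rotexp sg om a b s i 0)
    (rotexp sg om (sg *: a - om *: b) (om *: a + sg *: b) t i 0).
Proof.
have lin (c : R) : is_derive t (1 : R) (fun s => c * s) c.
  have := is_derive_prod (is_derive_cst c t 1) (is_derive_id t 1).
  by rewrite mul0r add0r mulr1.
have e1 := is_derive1_comp (is_derive_expR (sg * t)) (lin sg).
have e2 := is_derive1_comp (is_derive_cos (om * t)) (lin om).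
have e3 := is_derive1_comp (is_derive_sin (om * t)) (lin om).
have e2a := is_derive_prod e2 (is_derive_cst (a i 0) t 1).
have e3b := is_derive_prod e3 (is_derive_cst (b i 0) t 1).
have e := is_derive_prod e1 (is_deriveB e2a e3b).
rewrite (_ : (fun s => _) = (fun s => (expR \o (fun s => sg * s)) s *
    (((fun s => (cos \o (fun s => om * s)) s * cst (a i 0) s) -
      (fun s => (sin \o (fun s => om * s)) s * cst (b i 0) s)) s))).
  apply: is_derive_eq e _; rewrite /rotexp !mxE /=.
  have -> (f g : R -> R) : (f - g) t = f t - g t by [].
  ring.
by apply/funext => s; rewrite !mxE.
Qed.

Lemma rotexp_trajectory sg om (a b : 'cV[R]_k) (c d : 'cV[R]_m) :
  A *m a + B *m c = sg *: a - om *: b -> A *m b + B *m d = om *: a + sg *: b ->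
  trajectory A B (rotexp sg om c d) (rotexp sg om a b).
Proof.
move=> ha hb; split=> [j|t i].
  move=> t; have [/derivable1_diffP/differentiable_continuous] :=
    rotexp_derive sg om c d t j.
  by [].
have -> : A *m rotexp sg om a b t + B *m rotexp sg om c d t =
    rotexp sg om (sg *: a - om *: b) (om *: a + sg *: b) t.
  rewrite -ha -hb /rotexp -!scalemxAr -scalerDr !mulmxBr -!scalemxAr; congr (_ *: _).
  by rewrite !scalerDr opprD addrACA.
exact: rotexp_derive.
Qed.

Lemma rotexp_neg p (sg om t : R) (a b : 'cV[R]_p) :
  rotexp sg om b (- a) t = expR (sg * t) *: (cos (om * t) *: b + sin (om * t) *: a).
Proof. by rewrite /rotexp scalerN opprK. Qed.

(** Adding the products of the real parts and of the imaginary parts cancels the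
    oscillation. *)
Lemma rotexp_dot p (sg om t : R) (a b c d : 'cV[R]_p) :
  ((rotexp sg om a b t)^T *m rotexp sg om c d t) 0 0 +
  ((rotexp sg om b (- a) t)^T *m rotexp sg om d (- c) t) 0 0 =
  expR (sg * t) ^+ 2 * ((a^T *m c) 0 0 + (b^T *m d) 0 0).
Proof.
rewrite !rotexp_neg /rotexp.
have tD (x y : 'cV[R]_p) : (x + y)^T = x^T + y^T by rewrite linearD.
have tN (x : 'cV[R]_p) : (- x)^T = - x^T by rewrite linearN.
have tZ l (x : 'cV[R]_p) : (l *: x)^T = l *: x^T by rewrite linearZ.
set e := expR _; set u := cos _; set v := sin _.
have uv : u ^+ 2 = 1 - v ^+ 2 by rewrite -(cos2Dsin2 (om * t)) addrK.
rewrite !(tD, tN, tZ) -!scalemxAl -!scalemxAr.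
rewrite !(mulmxDl, mulmxDr, mulNmx, mulmxN) -!scalemxAl -!scalemxAr.
rewrite !mxE; move: (\sum_j _) (\sum_j _) (\sum_j _) (\sum_j _) => x y z w.
ring: uv.
Qed.

End Calculus.

(** * Passivity, controllability and observability *)

Section Systems.
Variable R : realType.
Variables (r m : nat) (A : 'M[R]_r) (B : 'M[R]_(r, m)) (C : 'M[R]_(m, r)).
Variable D : 'M[R]_m.
Local Open Scope classical_set_scope.

(** The states [Re (e^{st} w)] and [Im (e^{st} w)], with [s = sg + i om] and
    [w = a + i b], are driven by the inputs [Re (e^{st} h)] and [Im (e^{st} h)], with
    [h = c + i d].  If the conclusion failed, the two systems together would deliver
    energy at a rate bounded away from zero, because [0 <= sg], and so an infinite
    amount, against the nonnegativity of the storage function. *)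
Lemma passive_positive_real (sg om : R) (a b : 'cV[R]_r) (c d : 'cV[R]_m) :
  passive A B C D -> 0 <= sg ->
  A *m a + B *m c = sg *: a - om *: b -> A *m b + B *m d = om *: a + sg *: b ->
  0 <= (c^T *m (C *m a + D *m c)) 0 0 + (d^T *m (C *m b + D *m d)) 0 0.
Proof.
move=> [V [_ V0 Vdis]] sg0 ha hb.
have tr1 := rotexp_trajectory ha hb.
have hb' : A *m b + B *m d = sg *: b - om *: (- a) by rewrite hb scalerN opprK addrC.
have ha' : A *m (- a) + B *m (- c) = om *: b + sg *: (- a).
  by rewrite !mulmxN -opprD ha opprB scalerN.
have tr2 := rotexp_trajectory hb' ha'.
set u1 := rotexp sg om c d in tr1; set x1 := rotexp sg om a b in tr1.
set u2 := rotexp sg om d (- c) in tr2; set x2 := rotexp sg om b (- a) in tr2.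
have dotC (x y : 'cV[R]_m) : (x^T *m y) 0 0 = (y^T *m x) 0 0.
  by have := form_tr 1%:M x y; rewrite trmx1 !mulmx1.
rewrite !(dotC _ (_ + _)); set al := _ + _; rewrite leNgt; apply/negP => al0.
pose s (x : R -> 'cV[R]_r) u (t : R) := ((C *m x t + D *m u t)^T *m u t) 0 0.
(* The two supply rates add up to a rate without oscillation. *)
have s12 t : s x1 u1 t + s x2 u2 t = expR (sg * t) ^+ 2 * al.
  rewrite /al -(rotexp_dot sg om t) /s; congr (_ + _); congr (fun_of_matrix (trmx _ *m _) 0 0).
    rewrite /x1 /u1 /rotexp -!scalemxAr -scalerDr !mulmxBr -!scalemxAr; congr (_ *: _).
    by rewrite !scalerDr opprD addrACA.
  rewrite /x2 /u2 !rotexp_neg -!scalemxAr -scalerDr !mulmxDr -!scalemxAr; congr (_ *: _).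
  by rewrite !scalerDr addrACA.
(* By this time more energy than [V (x1 0) + V (x2 0)] would have been extracted. *)
pose T := (1 + V (x1 0) + V (x2 0)) / (- al).
have T0 : 0 <= T.
  by rewrite divr_ge0 // ?oppr_ge0 ?(ltW al0) // !addr_ge0.
have itv_int (f : R -> R) : continuous f ->
    (@lebesgue_measure R).-integrable `[0, T] (EFin \o f).
  move=> fc; apply: continuous_compact_integrable; first exact: segment_compact.
  by apply: continuous_subspaceT; exact: fc.
have s1c : continuous (s x1 u1) by exact: supply_continuous tr1.
have s2c : continuous (s x2 u2) by exact: supply_continuous tr2.
have := Vdis _ _ _ _ tr1 T0; have := Vdis _ _ _ _ tr2 T0.
pose I x u := \int[@lebesgue_measure R]_(t in `[0, T]) s x u t.
rewrite -/(I x1 u1) -/(I x2 u2) => i2 i1.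
have : \int[@lebesgue_measure R]_(t in `[0, T]) (s x1 u1 t + s x2 u2 t) <= al * T.
  apply: (@le_trans _ _ (\int[@lebesgue_measure R]_(t in `[0, T]) cst al t)).
    apply: le_Rintegral => //.
    - by apply: itv_int => t; apply: cvgD; [exact: s1c|exact: s2c].
    - by apply: itv_int => t; exact: cvg_cst.
    - move=> t /=; rewrite in_itv /= => /andP[t0 _]; rewrite s12 /=.
      rewrite -[leRHS]mul1r ler_wnM2r ?(ltW al0) //.
      by rewrite expr_ge1 ?expR_ge0 // -expR0 ler_expR mulr_ge0.
  rewrite Rintegral_cst //= lebesgue_measure_itv /= lte_fin.
  by case: ltP => // T0'; rewrite /= ?subr0 // -(le_anti (introT andP (conj T0 T0'))) mulr0.
rewrite RintegralD //; [|exact: itv_int|exact: itv_int].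
rewrite -/(I x1 u1) -/(I x2 u2).
have := V0 (x1 T); have := V0 (x2 T).
have -> : al * T = - (1 + V (x1 0) + V (x2 0)).
  by rewrite /T invrN mulrN mulrC mulNr mulrVK // unitfE lt_eqF.
move: i1 i2; move: (I x1 u1) (I x2 u2) (V (x1 T)) (V (x2 T)) => I1 I2 V1 V2.
by move: (V (x1 0)) (V (x2 0)) => W1 W2; lra.
Qed.

(** The frequency inequality at a real [s] tending to infinity: the response [w] to the
    input [e^{st} u] tends to [0], and only the feedthrough [D] remains. *)
Lemma passive_feedthrough_ge0 (u : 'cV[R]_m) :
  passive A B C D -> 0 <= (u^T *m D *m u) 0 0.
Proof.
move=> pas; pose al := 1 + fro A A.
have A0 := fro_ge0 A.
have al_fro : fro A A <= al ^+ 2 by rewrite /al; nra.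
have al0 : 0 <= al by rewrite /al; lra.
have Aform := form_le_fro _ al0 al_fro.
have dotE p (x y : 'cV[R]_p) : fro x y = (x^T *m y) 0 0 by rewrite /fro trace_mx11.
rewrite leNgt; apply/negP => g0; set g := _ 0 0 in g0.
pose bb := fro (B *m u) (B *m u); pose cc := fro (C^T *m u) (C^T *m u).
have bb0 : 0 <= bb := fro_ge0 _; have cc0 : 0 <= cc := fro_ge0 _.
have gg : 0 < g ^+ 2 by rewrite exprn_even_gt0 //= lt_eqF.
(* With this [sg] the response [w] is too small for [u^T *m C *m w] to outweigh [g]. *)
pose sg := (1 + cc * bb) / g ^+ 2.
have sg0 : 0 < sg by rewrite divr_gt0 // ltr_pwDl // mulr_ge0.
pose s := al + 1 + sg; have s0 : 0 <= s by rewrite /s; lra.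
have [w wE] : exists w, A *m w + B *m u = s *: w.
  have [z|Z ZE] := @inj_left_inverse _ _ _ (s%:M - A).
    rewrite mulmxBl mul_scalar_mx => /eqP; rewrite subr_eq0 => /eqP sz.
    have := Aform z; rewrite -mulmxA -sz -scalemxAr mxE => h.
    have z0 := sqn_ge0 z; apply: sqn_eq0; apply/eqP; rewrite eq_le z0 andbT.
    have : (1 + sg) * (z^T *m z) 0 0 <= 0.
      by move: h; rewrite /s; move: ((z^T *m z) 0 0) z0 => x x0; lra.
    by rewrite pmulr_rle0 // addr_gt0.
  exists (Z *m (B *m u)).
  have := mulmx1C ZE => /(congr1 (mulmx^~ (B *m u))).
  rewrite /= mul1mx -mulmxA mulmxBl mul_scalar_mx => h.
  by rewrite -{2}h addrC subrK.
have := @passive_positive_real s 0 w 0 u 0 pas s0.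
rewrite scaler0 subr0 !mulmx0 addr0 scale0r add0r scaler0 => /(_ wE erefl).
rewrite addr0 mulmx0 [X in _ + X]mxE addr0 mulmxDr mxE !mulmxA -/g.
have -> : (u^T *m C *m w) 0 0 = fro (C^T *m u) w by rewrite dotE trmx_mul trmxK.
move=> h.
have w0 := fro_ge0 w.
have wb : sg * fro w w <= bb.
  have := fro_ge0 (w - B *m u); rewrite !(froDl, froDr, froNl, froNr) -/bb.
  have := Aform w; rewrite -dotE.
  have : fro w (A *m w) + fro w (B *m u) = s * fro w w by rewrite -froDr wE froZr.
  rewrite (froC (B *m u)) [fro w (A *m w)]dotE mulmxA.
  rewrite /s; move: (fro w w) w0 => x x0; lra.
have CS := fro_CS (C^T *m u) w; rewrite -/cc in CS.
set f := fro (C^T *m u) w in h CS.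
have gf : g ^+ 2 <= f ^+ 2 by rewrite -sqrrN ler_pXn2r // ?nnegrE; lra.
have : g ^+ 2 * sg <= cc * bb.
  apply: (@le_trans _ _ (cc * fro w w * sg)).
    by rewrite ler_wpM2r ?(ltW sg0) // (le_trans gf).
  by rewrite -mulrA ler_wpM2l // mulrC.
by rewrite /sg mulrC divfK ?gt_eqF //; lra.
Qed.

(** Along a trajectory the complex number [z = (a + i b)^T x] satisfies
    [z' = (sg + i om) z], because the input does not enter; so it stays at [0] when
    it starts there, whereas controllability makes [x] reach every vector. *)
Lemma controllable_hautus (sg om : R) (a b : 'cV[R]_r) :
  controllable A B ->
  A^T *m a = sg *: a - om *: b -> A^T *m b = om *: a + sg *: b ->
  B^T *m a = 0 -> B^T *m b = 0 -> a = 0 /\ b = 0.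
Proof.
move=> ctrl ha hb Ba Bb.
suff key (v : 'cV[R]_r) : (a^T *m v) 0 0 = 0 /\ (b^T *m v) 0 0 = 0.
  by split; apply: sqn_eq0; have [] := key a; have [] := key b.
have [T [u [x [T0 tr x0 xT]]]] := ctrl 0 v.
pose p t := (a^T *m x t) 0 0; pose q t := (b^T *m x t) 0 0.
have aA t : a^T *m (A *m x t + B *m u t) = sg *: (a^T *m x t) - om *: (b^T *m x t).
  rewrite mulmxDr !mulmxA -[a^T *m B]trmxK trmx_mul trmxK Ba trmx0 mul0mx addr0.
  have -> : a^T *m A = sg *: a^T - om *: b^T; last by rewrite mulmxBl !scalemxAl.
  apply: trmx_inj; rewrite trmx_mul trmxK ha.
  by apply/matrixP => i j; rewrite !mxE.
have bA t : b^T *m (A *m x t + B *m u t) = om *: (a^T *m x t) + sg *: (b^T *m x t).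
  rewrite mulmxDr !mulmxA -[b^T *m B]trmxK trmx_mul trmxK Bb trmx0 mul0mx addr0.
  have -> : b^T *m A = om *: a^T + sg *: b^T; last by rewrite mulmxDl !scalemxAl.
  apply: trmx_inj; rewrite trmx_mul trmxK hb.
  by apply/matrixP => i j; rewrite !mxE.
have pd t : is_derive t (1 : R) p (sg * p t - om * q t).
  have [_ xd] := tr; have := is_derive_mulmx a^T 0 (xd t).
  by rewrite aA mxE [X in _ + X]mxE [X in X - _]mxE [X in _ - X]mxE.
have qd t : is_derive t (1 : R) q (om * p t + sg * q t).
  have [_ xd] := tr; have := is_derive_mulmx b^T 0 (xd t).
  by rewrite bA mxE [X in X + _]mxE [X in _ + X]mxE.
(* [|z|^2] with its exponential growth removed. *)
pose ph t := (p t * p t + q t * q t) * expR (- (2 * sg) * t).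
have phd t : is_derive t (1 : R) ph 0.
  have lin : is_derive t (1 : R) (fun s => - (2 * sg) * s) (- (2 * sg)).
    have := is_derive_prod (is_derive_cst (- (2 * sg)) t 1) (is_derive_id t 1).
    by rewrite mul0r add0r mulr1.
  have e1 := is_derive1_comp (is_derive_expR (- (2 * sg) * t)) lin.
  have := is_derive_prod (is_deriveD (is_derive_prod (pd t) (pd t))
    (is_derive_prod (qd t) (qd t))) e1.
  move=> e; apply: is_derive_eq e _.
  have -> (f1 f2 : R -> R) : (f1 + f2) t = f1 t + f2 t by [].
  by rewrite /=; ring.
have phT : ph T = 0.
  rewrite (is_derive_0_is_cst (f := ph) T 0) /ph /p /q x0 !mulmx0 mxE.
  by rewrite !mulr0 addr0 mul0r.
have : p T * p T + q T * q T = 0.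
  by move/eqP: phT; rewrite mulf_eq0 (gt_eqF (expR_gt0 _)) orbF => /eqP.
move=> /eqP; rewrite paddr_eq0 -?expr2 ?sqr_ge0 // !sqrf_eq0 /p /q xT.
by move=> /andP[/eqP -> /eqP ->].
Qed.

(** The free motion [Re (e^{st} (a + i b))], with [s = sg + i om], has zero output,
    like the motion that stays at [0]. *)
Lemma observable_hautus (sg om : R) (a b : 'cV[R]_r) :
  observable A B C D ->
  A *m a = sg *: a - om *: b -> A *m b = om *: a + sg *: b ->
  C *m a = 0 -> C *m b = 0 -> a = 0 /\ b = 0.
Proof.
move=> [T T0 obs] ha hb Ca Cb.
have key (a' b' : 'cV[R]_r) : A *m a' = sg *: a' - om *: b' ->
    A *m b' = om *: a' + sg *: b' -> C *m a' = 0 -> C *m b' = 0 -> a' = 0.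
  move=> ha' hb' Ca' Cb'.
  have tr1 : trajectory A B (rotexp sg om 0 0) (rotexp sg om a' b').
    by apply: rotexp_trajectory; rewrite mulmx0 addr0.
  have tr0 : trajectory A B (rotexp sg om 0 0) (rotexp sg om 0 0).
    by apply: rotexp_trajectory; rewrite !mulmx0 !scaler0 ?subr0 ?addr0.
  have := obs _ _ _ tr1 tr0.
  rewrite /rotexp !mulr0 expR0 cos0 sin0 !scale1r !scale0r !subr0; apply=> t _.
  by rewrite -!scalemxAr !mulmxBr -!scalemxAr Ca' Cb' !mulmx0.
split; first exact: (key a b).
apply: (key b (- a)) => //.
- by rewrite hb scalerN opprK addrC.
- by rewrite mulmxN ha opprB scalerN.
- by rewrite mulmxN Ca oppr0.
Qed.

Lemma controllable_ker (M : 'M[R]_r) : controllable A B ->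
  (forall v : 'cV_r, M *m v = 0 -> M *m (A^T *m v) = 0 /\ B^T *m v = 0) ->
  forall v : 'cV_r, M *m v = 0 -> v = 0.
Proof.
move=> ctrl MA v Mv; apply/eqP; apply: contraT => v0.
have [w /MA[]//|al [be [a [b [ab Ma Mb Aa Ab]]]]] :=
  @real_eigenpair _ _ _ M A^T _ (ex_intro2 _ _ v v0 Mv).
have [_ Ba] := MA _ Ma; have [_ Bb] := MA _ Mb.
have [a0 b0] := controllable_hautus ctrl Aa Ab Ba Bb.
by rewrite a0 b0 eqxx in ab.
Qed.

Lemma observable_ker (M : 'M[R]_r) : observable A B C D ->
  (forall v : 'cV_r, M *m v = 0 -> M *m (A *m v) = 0 /\ C *m v = 0) ->
  forall v : 'cV_r, M *m v = 0 -> v = 0.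
Proof.
move=> obs MA v Mv; apply/eqP; apply: contraT => v0.
have [w /MA[]//|al [be [a [b [ab Ma Mb Aa Ab]]]]] :=
  @real_eigenpair _ _ _ M A _ (ex_intro2 _ _ v v0 Mv).
have [_ Ca] := MA _ Ma; have [_ Cb] := MA _ Mb.
have [a0 b0] := observable_hautus obs Aa Ab Ca Cb.
by rewrite a0 b0 eqxx in ab.
Qed.

(** The form of [kyp X] is the dissipation: twice the supply rate minus the rate of
    change of [x^T X x]. *)
Lemma kyp_form (X : 'M[R]_r) (x : 'cV[R]_r) (u : 'cV[R]_m) : X^T = X ->
  ((col_mx x u)^T *m kyp A B C D X *m col_mx x u) 0 0 =
  2 * ((C *m x + D *m u)^T *m u) 0 0 - ((A *m x + B *m u)^T *m (X *m x)) 0 0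
  - (x^T *m (X *m (A *m x + B *m u))) 0 0.
Proof.
move=> Xs.
have dotC p (y z : 'cV[R]_p) : (y^T *m z) 0 0 = (z^T *m y) 0 0.
  by have := form_tr 1%:M y z; rewrite trmx1 !mulmx1.
pose bil p q (y : 'cV[R]_p) (M : 'M[R]_(p, q)) (z : 'cV[R]_q) := (y^T *m M *m z) 0 0.
have bT p q (y : 'cV[R]_p) (M : 'M[R]_(p, q)) (z : 'cV[R]_q) : bil _ _ y M z = bil _ _ z M^T y.
  rewrite /bil; have <- : (y^T *m M *m z)^T 0 0 = (y^T *m M *m z) 0 0 by rewrite mxE.
  by rewrite !trmx_mul trmxK mulmxA.
have -> : ((C *m x + D *m u)^T *m u) 0 0 = bil _ _ u C x + bil _ _ u D u.
  by rewrite dotC /bil mulmxDr mxE !mulmxA.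
have -> : ((A *m x + B *m u)^T *m (X *m x)) 0 0 = bil _ _ x (X *m A) x + bil _ _ x (X *m B) u.
  by rewrite dotC trmx_mul Xs /bil mulmxDr mxE !mulmxA.
have -> : (x^T *m (X *m (A *m x + B *m u))) 0 0 = bil _ _ x (X *m A) x + bil _ _ x (X *m B) u.
  by rewrite /bil !mulmxDr mxE !mulmxA.
rewrite /kyp -mulmxA mul_block_col tr_col_mx mul_row_col.
have bD p q (y : 'cV[R]_p) (M N : 'M[R]_(p, q)) z :
    bil _ _ y (M + N) z = bil _ _ y M z + bil _ _ y N z.
  by rewrite /bil mulmxDr mulmxDl mxE.
have bN p q (y : 'cV[R]_p) (M : 'M[R]_(p, q)) z : bil _ _ y (- M) z = - bil _ _ y M z.
  by rewrite /bil mulmxN mulNmx mxE.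
rewrite mxE 2!mulmxDr mxE [X in _ + X]mxE !mulmxA -!/(bil _ _ _ _ _).
rewrite !(bD, bN) (bT _ _ x (A^T *m X)) (bT _ _ x C^T) (bT _ _ u (B^T *m X)) (bT _ _ u D^T).
rewrite !trmx_mul !trmxK Xs.
ring.
Qed.

(** The derivative of [x^T X x] is at most twice the supply rate plus the squared norms
    of state and input, which is independent of [X]. *)
Lemma storage_increase_bound (u : R -> 'cV[R]_m) (x : R -> 'cV[R]_r) (T : R) :
  trajectory A B u x -> 0 < T ->
  exists M, forall X, X^T = X /\ psdmx (kyp A B C D X + 1%:M) ->
    ((x T)^T *m (X *m x T)) 0 0 - ((x 0)^T *m (X *m x 0)) 0 0 <= M.
Proof.
move=> tr T0; have [uc xd] := tr.
have xc j : continuous (fun t => x t j 0) by exact: trajectory_continuous tr.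
pose g t := 2 * ((C *m x t + D *m u t)^T *m u t) 0 0
  + (((x t)^T *m x t) 0 0 + ((u t)^T *m u t) 0 0).
have gc : continuous g.
  move=> t; apply: cvgD; last by apply: cvgD; exact: continuous_dot.
  by apply: cvgM; [exact: cvg_cst|exact: (supply_continuous tr)].
have [c _ cmax] := EVT_max (ltW T0) (continuous_subspaceT gc).
exists (g c * T) => X [Xs [_ KX]].
pose f t := ((x t)^T *m (X *m x t)) 0 0.
pose dx t := A *m x t + B *m u t.
have fd t : is_derive t (1 : R) f
    (((dx t)^T *m (X *m x t)) 0 0 + ((x t)^T *m (X *m dx t)) 0 0).
  have Xxd j := is_derive_mulmx X j (xd t).
  exact: (is_derive_dot (xd t) Xxd).
have fc : {within `[0, T], continuous f}.
  apply: continuous_subspaceT; apply: continuous_dot => //.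
  by move=> j; apply: continuous_mulmx.
have [s sT ->] := MVT T0 (fun t _ => fd t) fc.
rewrite subr0 ler_pM2r //.
apply: (@le_trans _ _ (g s)); last by apply: cmax; exact: subset_itv_oo_cc.
have := KX (col_mx (x s) (u s)).
rewrite mulmxDr mulmxDl mxE mulmx1 kyp_form // tr_col_mx mul_row_col [X in _ + X]mxE.
by rewrite /g /dx; lra.
Qed.

(** Trajectories from [0] to [v] bound the form of [X] at [v] from above, trajectories
    from [v] to [0] bound it from below. *)
Lemma kyp_bounded : controllable A B ->
  exists b, forall X, X^T = X /\ psdmx (kyp A B C D X + 1%:M) -> fro X X <= b.
Proof.
move=> ctrl; apply: fro_bounded_of_forms => [X []//|v].
have [T1 [u1 [x1 [T10 tr1 x10 x1T]]]] := ctrl 0 v.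
have [T2 [u2 [x2 [T20 tr2 x20 x2T]]]] := ctrl v 0.
have [M1 M1P] := storage_increase_bound tr1 T10.
have [M2 M2P] := storage_increase_bound tr2 T20.
exists (Num.max M1 M2) => X SX; rewrite -mulmxA.
have := M1P X SX; have := M2P X SX; rewrite x10 x1T x20 x2T !mulmx0.
rewrite [X in X - _]mxE sub0r [X in _ - X]mxE subr0 => h2 h1.
by rewrite ler_norml lerNl !le_max h1 h2 orbT.
Qed.

End Systems.

(** * Existence and uniqueness of the minimizer *)

Section Minimizer.
Variable R : realType.
Variables (r m : nat) (A : 'M[R]_r) (B : 'M[R]_(r, m)) (C : 'M[R]_(m, r)).
Variable D : 'M[R]_m.
Local Notation K := (kyp A B C D).

(** The positive real lemma. *)
Lemma passive_kyp : passive A B C D -> controllable A B ->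
  exists2 X, X^T = X & psdmx (K X).
Proof.
move=> pas ctrl; apply: kyp_solvable; last exact: kyp_bounded ctrl.
apply: kyp_approx => [om a b c d ha hb|u]; last exact: passive_feedthrough_ge0 pas.
apply: (passive_positive_real pas (lexx 0) (om := om)).
  by rewrite scale0r sub0r ha scaleNr.
by rewrite scale0r addr0.
Qed.

(** By the matrix inequality the kernel of [X] is stable under [A] and contained in the
    kernel of [C]. *)
Lemma kyp_pd (X : 'M[R]_r) : asymptotically_stable A -> observable A B C D ->
  X^T = X -> psdmx (K X) -> pdmx X.
Proof.
move=> sA obs Xs psdK; have [_ K0] := psdK.
have formE (v : 'cV[R]_r) : ((col_mx v 0)^T *m K X *m col_mx v 0) 0 0 =
    - (v^T *m (A^T *m X + X *m A) *m v) 0 0.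
  rewrite /kyp -mulmxA mul_block_col !mulmx0 !addr0 tr_col_mx mul_row_col trmx0 mul0mx.
  by rewrite addr0 mulmxA -opprD mulmxN mulNmx mxE.
apply: psd_inj_pd.
  apply: (lyapunov_psd (stable_tr sA) Xs) => v; rewrite trmxK -oppr_ge0 -formE.
  exact: K0.
apply: (observable_ker obs) => v Xv.
have : K X *m col_mx v 0 = 0.
  apply: (psd_kernel psdK); rewrite formE mulmxDr mulmxDl -!mulmxA Xv !mulmx0.
  by rewrite add0r !mulmxA -{1}Xs -trmx_mul Xv trmx0 !mul0mx mxE oppr0.
rewrite /kyp mul_block_col !mulmx0 !addr0 !mulmxBl mulNmx -!mulmxA Xv !mulmx0.
rewrite oppr0 sub0r subr0 -[X in _ = X](@vsubmxK _ r m) !linear0 => /eq_col_mx [h ->].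
by split=> //; apply/eqP; rewrite -oppr_eq0 h.
Qed.

(** By the Lyapunov equation the kernel of [P] is stable under [A^T] and contained in
    the kernel of [B^T]. *)
Lemma gramian_pd (P : 'M[R]_r) : asymptotically_stable A -> controllable A B ->
  sylvester_eq A B A B P -> pdmx P.
Proof.
move=> sA ctrl Peq; have [P' [_ uP]] := sylvester_unique B B sA sA.
have Ps : P^T = P.
  have hT : sylvester_eq A B A B P^T.
    have := congr1 trmx Peq; rewrite !linearD /= !trmx_mul !trmxK trmx0.
    rewrite /sylvester_eq => <-.
    by congr (_ + _); exact: addrC.
  by rewrite -(uP _ hT); exact: uP.
have PE : A *m P + P *m A^T = - (B *m B^T) by apply/eqP; rewrite -addr_eq0; apply/eqP.
have formE (v : 'cV[R]_r) : (v^T *m (A *m P + P *m A^T) *m v) 0 0 =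
    - ((B^T *m v)^T *m (B^T *m v)) 0 0.
  by rewrite PE mulmxN mulNmx mxE trmx_mul trmxK !mulmxA.
apply: psd_inj_pd.
  by apply: (lyapunov_psd sA Ps) => v; rewrite formE oppr_le0 sqn_ge0.
apply: (controllable_ker ctrl) => v Pv.
have Bv : B^T *m v = 0.
  apply: sqn_eq0; apply/eqP; rewrite -oppr_eq0 -formE mulmxDr mulmxDl -!mulmxA Pv !mulmx0.
  by rewrite add0r !mulmxA -{1}Ps -trmx_mul Pv trmx0 !mul0mx mxE.
split=> //; have := congr1 (mulmx^~ v) PE.
by rewrite /= mulmxDl mulNmx -!mulmxA Pv Bv !mulmx0 oppr0 add0r.
Qed.

Lemma kyp_feasibleE (X : 'M[R]_r) : asymptotically_stable A -> observable A B C D ->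
  kyp_feasible A B C D X <-> X^T = X /\ psdmx (K X).
Proof.
move=> sA obs; split=> [[[Xs _] XK]|[Xs XK]] //.
by split=> //; exact: kyp_pd XK.
Qed.

(** Completion of the square in the variable [G^T *m X *m G]. *)
Lemma h2_cost_square n k (Q P : 'M[R]_n) (Y : 'M[R]_(n, r)) (G : 'M[R]_(r, k))
    (Z : 'M[R]_(k, r)) (X : 'M[R]_r) : Q^T = Q -> X^T = X -> G *m Z = 1%:M ->
  let W := Z *m (Y^T *m Q *m Y) *m Z^T in
  h2_cost Q P (G *m G^T) Y X =
  4^-1 * fro (G^T *m X *m G - W) (G^T *m X *m G - W) +
  (4^-1 * \tr (P *m Q *m P *m Q) - 4^-1 * fro W W).
Proof.
move=> Qs Xs GZ W; rewrite /h2_cost; set V := G^T *m X *m G.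
have Vs : V^T = V by rewrite /V !trmx_mul trmxK Xs mulmxA.
have -> : \tr (G *m G^T *m X *m (G *m G^T) *m X) = fro V V.
  by rewrite /fro Vs /V -!mulmxA mxtrace_mulC !mulmxA.
have -> : \tr (Y^T *m Q *m Y *m X) = fro W V.
  rewrite /fro /W /V !trmx_mul !trmxK Qs !mulmxA.
  rewrite -(mulmxA _ Z^T) -trmx_mul GZ trmx1 mulmx1.
  by rewrite [RHS]mxtrace_mulC !mulmxA GZ mul1mx.
by rewrite !(froDl, froDr, froNl, froNr) (froC V W); field.
Qed.

Lemma h2_cost_unique_min n (Q P : 'M[R]_n) (Pt : 'M[R]_r) (Y : 'M[R]_(n, r)) :
  asymptotically_stable A -> minimal A B C D -> passive A B C D -> Q^T = Q ->
  sylvester_eq A B A B Pt ->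
  exists! X, minimizer (kyp_feasible A B C D) (h2_cost Q P Pt Y) X.
Proof.
move=> sA [ctrl obs] pas Qs PtE.
have [X1 X1s X1K] := passive_kyp pas ctrl.
have feasE X := kyp_feasibleE X sA obs.
have pdP := gramian_pd sA ctrl PtE.
have psdP : psdmx Pt.
  have [Ps P0] := pdP; split=> // x; have [->|x0] := eqVneq x 0.
    by rewrite mulmx0 mxE.
  exact/ltW/P0.
have [k [G [PtG Ginj]]] := psd_factor psdP.
have [Z ZG] := inj_left_inverse Ginj.
have GZ : G *m Z = 1%:M.
  have [z Gz|Z' Z'G] := @inj_left_inverse _ _ _ G^T.
    apply/eqP; apply: contraT => z0; have [_ /(_ z z0)] := pdP.
    by rewrite PtG -!mulmxA Gz !mulmx0 mxE ltxx.
  have GZ' : G *m Z'^T = 1%:M by rewrite -[G]trmxK -trmx_mul Z'G trmx1.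
  by rewrite -[Z]mulmx1 -GZ' [Z *m _]mulmxA ZG mul1mx.
pose W := Z *m (Y^T *m Q *m Y) *m Z^T.
pose V X := G^T *m X *m G - W.
have VK X : Z^T *m (V X + W) *m Z = X.
  by rewrite /V subrK !mulmxA -trmx_mul GZ trmx1 mul1mx -mulmxA GZ mulmx1.
have KV U : V (Z^T *m (U + W) *m Z) = U.
  rewrite /V !mulmxA -trmx_mul ZG trmx1 mul1mx -!mulmxA ZG mulmx1.
  by rewrite addrK.
pose c := 4^-1 * \tr (P *m Q *m P *m Q) - 4^-1 * fro W W.
have JE X : X^T = X -> h2_cost Q P Pt Y X = 4^-1 * fro (V X) (V X) + c.
  by move=> Xs; rewrite PtG (h2_cost_square _ _ Qs Xs GZ).
pose S U := exists2 X, X^T = X /\ psdmx (K X) & U = V X.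
have Smid U1 U2 : S U1 -> S U2 -> S (2^-1 *: (U1 + U2)).
  move=> [Y1 [Y1s Y1K] ->] [Y2 [Y2s Y2K] ->].
  exists (2^-1 *: Y1 + 2^-1 *: Y2); last first.
    have WE : W = 2^-1 *: W + 2^-1 *: W.
      by rewrite -scalerDl -[X in X = _]scale1r; congr (_ *: _); field.
    rewrite /V mulmxDr mulmxDl -!scalemxAr -!scalemxAl {3}WE.
    by rewrite !scalerDr !scalerN opprD addrACA.
  split; first by rewrite linearD !linearZ /= Y1s Y2s.
  rewrite kyp_comb; last by field.
  by apply: psd_add; apply: psd_scale => //; rewrite invr_ge0.
have [|||E [SE Emin]] := @nested_min_norm R _ _ (fun=> S) (fro (V X1) (V X1)).
- by move=> _; exact: Smid.
- by [].
- by move=> _; exists (V X1) => //; exists X1.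
have {Emin}Emin U : S U -> fro E E <= fro U U by move=> SU; exact: Emin.
pose X0 := Z^T *m (E + W) *m Z.
have VX0 : V X0 = E := KV E.
have [X0s X0K] : X0^T = X0 /\ psdmx (K X0).
  suff [? h] : X0^T = X0 /\ psdmx (K X0 + 0%:M) by move: h; rewrite raddf0 addr0.
  pose S' U := exists2 X, X^T = X /\ psdmx (K X) & U = V X + W.
  have lim : fro_limit S' (E + W).
    move=> e e0; have [_ [X XP ->] XE] := SE 0%N e e0.
    exists (V X + W); first by exists X.
    by rewrite opprD addrACA subrr addr0.
  apply: kyp_limit (congruence_limit Z lim) => _ [_ [X [Xs XK] ->] ->].
  by rewrite VK raddf0 addr0.
exists X0; split.
  split; first exact/feasE.
  move=> X /feasE [Xs XK]; rewrite !JE // VX0 lerD2r ler_pM2l ?invr_gt0 //.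
  by apply: Emin; exists X.
move=> X [/feasE [Xs XK] /(_ X0)]; rewrite !JE // VX0 lerD2r ler_pM2l ?invr_gt0 //.
move=> Xmin; rewrite -[RHS]VK /X0; congr (_ *m (_ + _) *m _).
have SX : S (V X) by exists X.
have SE0 : S E by exists X0.
have {}Xmin : fro (V X) (V X) <= fro E E by apply: Xmin; exact/feasE.
apply/eqP; rewrite -subr_eq0; apply/eqP/fro_eq0; apply/eqP.
rewrite eq_le fro_ge0 andbT parallelogram.
have := Emin _ (Smid _ _ SE0 SX); lra.
Qed.

End Minimizer.

Theorem theorem5p4 (R : realType) (n m r : nat)
    (J Rd Q : 'M[R]_n) (G P : 'M[R]_(n, m)) (S N : 'M[R]_m)
    (At : 'M[R]_r) (Bt : 'M[R]_(r, m)) (Ct : 'M[R]_(m, r)) (Dt : 'M[R]_m)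
    (hpH : port_hamiltonian J Rd Q G P S N)
    (hA : asymptotically_stable ((J - Rd) *m Q))
    (hmin : minimal At Bt Ct Dt)
    (hAt : asymptotically_stable At)
    (hpass : passive At Bt Ct Dt) :
  let A := (J - Rd) *m Q in
  let B := G - P in
  exists (Pc : 'M[R]_n) (Pt : 'M[R]_r) (Y : 'M[R]_(n, r)),
    [/\ unique (sylvester_eq A B A B) Pc,
        unique (sylvester_eq At Bt At Bt) Pt,
        unique (sylvester_eq A B At Bt) Y
      & exists! Qt : 'M[R]_r,
          minimizer (kyp_feasible At Bt Ct Dt) (h2_cost Q Pc Pt Y) Qt].
Proof.
move=> A B; have [_ _ [Qs _]] := hpH.
have [Pc hPc] := sylvester_unique B B hA hA.
have [Pt hPt] := sylvester_unique Bt Bt hAt hAt.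
have [Y hY] := sylvester_unique B Bt hA hAt.
exists Pc, Pt, Y; split=> //.
by apply: h2_cost_unique_min => //; have [] := hPt.
Qed.
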